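(* Let $\mathcal{D}$ be a $C^1_c(\mathbb{R}^2)$-stable algebra of bounded real-valued functions on a nonempty set $X$ containing a strictly positive function $\chi>0$, and let $(\mathcal{E},\mathcal{D})$ be a sup-norm-closable bilinear form on which normal contractions operate. Let $m$ be a finite energy dominant measure for $(\mathcal{E},\mathcal{D})$, and denote also by $m$ its unique extension to $\sigma(\mathcal{D})$. Then $(\mathcal{E},\mathcal{D})$ is closable on $L_2(X,\sigma(\mathcal{D}),m)$, i.e. whenever $(f_n)_n\subset\mathcal{D}$ is $\mathcal{E}$-Cauchy and $f_n\to0$ in $L_2(X,m)$ one has $\mathcal{E}(f_n)\to0$. Its closure is a Dirichlet form on $L_2(X,m)$ which admits a carré du champ: for every $f\in\mathcal{D}$ the energy measure $\Gamma(f)$ extends to a measure on $\sigma(\mathcal{D})$ which has a density with respect to $m$ belonging to $L_1(X,m)$.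
   Context: All functions are bounded real-valued functions on a nonempty set $X$; spaces of such functions carry the supremum norm $\|f\|_{\sup}=\sup_{x\in X}|f(x)|$, and $\mathcal{D}^+$ denotes the nonnegative elements of $\mathcal{D}$. A bilinear form $(\mathcal{E},\mathcal{D})$ is a symmetric nonnegative definite bilinear map $\mathcal{E}:\mathcal{D}\times\mathcal{D}\to\mathbb{R}$; write $\mathcal{E}(f):=\mathcal{E}(f,f)$. A normal contraction is a map $F:\mathbb{R}\to\mathbb{R}$ with $F(0)=0$ and $|F(x)-F(y)|\le|x-y|$; normal contractions operate on $(\mathcal{E},\mathcal{D})$ if $F(f)\in\mathcal{D}$ and $\mathcal{E}(F(f))\le\mathcal{E}(f)$ for all $f\in\mathcal{D}$ and all normal contractions $F$. $(\mathcal{E},\mathcal{D})$ is sup-norm-closable if for every $\mathcal{E}$-Cauchy sequence $(f_n)\subset\mathcal{D}$ (i.e. $\mathcal{E}(f_n-f_m)\to0$) with $\|f_n\|_{\sup}\to0$ one has $\mathcal{E}(f_n)\to0$. $\mathcal{D}$ is $C^1_c(\mathbb{R}^2)$-stable if $\varphi(f,g)\in\mathcal{D}$ for all $f,g\in\mathcal{D}$ and all compactly supported $C^1$ functions $\varphi:\mathbb{R}^2\to\mathbb{R}$ with $\varphi(0)=0$. For $f,h\in\mathcal{D}$ put $L_f(h):=2\mathcal{E}(fh,f)-\mathcal{E}(f^2,h)$ (these functionals are positive under the hypotheses). Let $\mathcal{S}=\{\{f>0\}:f\in\mathcal{D}\}$, $\alpha(\mathcal{S})$ the algebra of subsets generated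 by $\mathcal{S}$, and $\sigma(\mathcal{D})$ the $\sigma$-algebra generated by $\mathcal{D}$. The energy measure of $f\in\mathcal{D}$ is the set function $\Gamma(f)(B):=\sup\{L_f(h):h\in\mathcal{D},0\le h\le\mathbf 1_B\}$ for $B\in\mathcal{S}$ and $\Gamma(f)(A):=\inf\{\Gamma(f)(B):B\in\mathcal{S},A\subset B\}$ for $A\subset X$, considered on $\alpha(\mathcal{S})$ (where it is finitely additive). A measure means a countably additive set function. A measure $m$ on $\alpha(\mathcal{S})$ is energy dominant for $(\mathcal{E},\mathcal{D})$ if for every $f\in\mathcal{D}$ and $\varepsilon>0$ there is $\delta>0$ such that $\Gamma(f)(A)<\varepsilon$ for all $A\in\alpha(\mathcal{S})$ with $m(A)<\delta$. *)

(* Defs.v *)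
From HB Require Import structures.
From mathcomp Require Import all_boot all_order all_algebra.
From mathcomp Require Import all_classical all_reals all_analysis.
Set Implicit Arguments. Unset Strict Implicit. Unset Printing Implicit Defensive.
Import Order.TTheory GRing.Theory Num.Theory.
Import numFieldNormedType.Exports.
Local Open Scope classical_set_scope.
Local Open Scope ring_scope.

Section Defs.
Variables (R : realType) (X : pointedType).

Definition bounded_fun (f : X -> R) := exists M : R, forall x, `|f x| <= M.

Definition supnorm (f : X -> R) : R := sup [set `|f x| | x in [set: X]].

Definition bounded_algebra (D : set (X -> R)) :=
  [/\ D (fun _ => 0),
      (forall f g, D f -> D g -> D (fun x => f x + g x)),
      (forall (a : R) f, D f -> D (fun x => a * f x)),
      (forall f g, D f -> D g -> D (fun x => f x * g x)) &
      (forall f, D f -> bounded_fun f)].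

Definition C1c (phi : R * R -> R) :=
  [/\ (forall p, derivable phi p (1, 0) /\ derivable phi p (0, 1)),
      continuous (fun p => 'D_(1, 0) phi p),
      continuous (fun p => 'D_(0, 1) phi p) &
      compact (closure [set p | phi p != 0])].

Definition C1c_stable (D : set (X -> R)) :=
  forall f g, D f -> D g -> forall phi : R * R -> R, C1c phi -> phi (0, 0) = 0 ->
    D (fun x => phi (f x, g x)).

Definition bilinear_form (E : (X -> R) -> (X -> R) -> R) (D : set (X -> R)) :=
  [/\ (forall f g, D f -> D g -> E f g = E g f),
      (forall f, D f -> 0 <= E f f) &
      (forall (a : R) f g h, D f -> D g -> D h ->
         E (fun x => a * f x + g x) h = a * E f h + E g h)].

Definition normal_contraction (F : R -> R) :=
  F 0 = 0 /\ forall x y, `|F x - F y| <= `|x - y|.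

Definition contractions_operate (E : (X -> R) -> (X -> R) -> R) (D : set (X -> R)) :=
  forall F, normal_contraction F -> forall f, D f ->
    D (F \o f) /\ E (F \o f) (F \o f) <= E f f.

Definition E_cauchy (E : (X -> R) -> (X -> R) -> R) (f : nat -> X -> R) :=
  forall eps : R, 0 < eps -> exists N, forall n k, (N <= n)%N -> (N <= k)%N ->
    E (fun x => f n x - f k x) (fun x => f n x - f k x) < eps.

Definition supnorm_closable (E : (X -> R) -> (X -> R) -> R) (D : set (X -> R)) :=
  forall f : nat -> X -> R, (forall n, D (f n)) -> E_cauchy E f ->
    supnorm (f n) @[n --> \oo] --> 0 ->
    E (f n) (f n) @[n --> \oo] --> 0.

Definition Lfun (E : (X -> R) -> (X -> R) -> R) (f h : X -> R) : R :=
  2 * E (fun x => f x * h x) f - E (fun x => f x ^+ 2) h.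

Definition Sets (D : set (X -> R)) : set (set X) :=
  [set [set x | 0 < f x] | f in D].

Definition set_algebra (F : set (set X)) :=
  [/\ F set0, (forall A, F A -> F (~` A)) & (forall A B, F A -> F B -> F (A `|` B))].

Definition alphaS (D : set (X -> R)) : set (set X) := smallest set_algebra (Sets D).

Definition GammaS (E : (X -> R) -> (X -> R) -> R) (D : set (X -> R)) (f : X -> R)
    (B : set X) : \bar R :=
  ereal_sup [set (Lfun E f h)%:E | h in
    [set h | D h /\ forall x, 0 <= h x <= \1_B x]].

Definition Gamma (E : (X -> R) -> (X -> R) -> R) (D : set (X -> R)) (f : X -> R)
    (A : set X) : \bar R :=
  if `[< Sets D A >] then GammaS E D f A
  else ereal_inf [set GammaS E D f B | B in [set B | Sets D B /\ A `<=` B]].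

Definition sigmaGen (D : set (X -> R)) : set (set X) :=
  [set A | exists f B, [/\ D f, measurable (B : set R) & A = f @^-1` B]].

Section MeasureDefs.
Variables (E : (X -> R) -> (X -> R) -> R) (D : set (X -> R)).
Variable m : {measure set (g_sigma_algebraType (sigmaGen D)) -> \bar R}.

Definition energy_dominant :=
  forall f, D f -> forall eps : R, 0 < eps -> exists2 delta : R, 0 < delta &
    forall A, alphaS D A -> (m A < delta%:E)%E -> (Gamma E D f A < eps%:E)%E.

Definition L2_to (f : nat -> X -> R) (u : X -> R) :=
  (\int[m]_x ((f n x - u x) ^+ 2)%:E)%E @[n --> \oo] --> 0%E.

Definition L2_closable :=
  forall f : nat -> X -> R, (forall n, D (f n)) -> E_cauchy E f ->
    L2_to f (fun _ => 0) -> E (f n) (f n) @[n --> \oo] --> 0.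

Definition closure_dense :=
  forall u : g_sigma_algebraType (sigmaGen D) -> R, measurable_fun setT u ->
    m.-integrable setT (fun x => (u x ^+ 2)%:E) ->
    exists f : nat -> X -> R, (forall n, D (f n)) /\ L2_to f u.

(** Markov property of the closure: if u is in the domain of the closure,
    approximated by the E-Cauchy sequence (f_n) of D, then the unit
    contraction (0 v u) ^ 1 is in the domain of the closure and its
    closure-energy is at most that of u. *)
Definition closure_markov :=
  forall (u : g_sigma_algebraType (sigmaGen D) -> R) (f : nat -> X -> R),
    measurable_fun setT u -> (forall n, D (f n)) -> E_cauchy E f -> L2_to f u ->
    exists g : nat -> X -> R,
      [/\ (forall n, D (g n)), E_cauchy E g,
          L2_to g (fun x => Num.min (Num.max (u x) 0) 1) &
          limn (fun n => E (g n) (g n)) <= limn (fun n => E (f n) (f n))].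

Definition carre_du_champ :=
  forall f, D f ->
    exists mu : {measure set (g_sigma_algebraType (sigmaGen D)) -> \bar R},
      (forall A, alphaS D A -> mu A = Gamma E D f A) /\
      exists g : g_sigma_algebraType (sigmaGen D) -> R,
        m.-integrable setT (EFin \o g) /\
        forall A, measurable A -> mu A = (\int[m]_(x in A) (g x)%:E)%E.

End MeasureDefs.

End Defs.

(* Main.v *)
Require Import Defs.
From HB Require Import structures.
From mathcomp Require Import all_boot all_order all_algebra.
From mathcomp Require Import all_classical all_reals all_analysis.
From mathcomp Require Import measurable_realfun.
From mathcomp Require Import ring lra.
Import Order.TTheory GRing.Theory Num.Theory.
Import numFieldNormedType.Exports.
Set Implicit Arguments. Unset Strict Implicit. Unset Printing Implicit Defensive.
Local Open Scope classical_set_scope.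
Local Open Scope ring_scope.

(* Everything rests on three inequalities for L_f(h) = 2 E(fh, f) - E(f^2, h):
   L_f >= 0, L_f(h) <= 2 E(f) if h <= 1, and E(tail_e f) <= L_f(h) if h >= 0 and
   h = 1 on {|f| > e}, where tail_e x = x - ((-e) \/ x /\ e).  They hold for every
   jump-and-killing form on a finite set, and E is approximated by such forms.
   Sup-norm closability makes E lower semicontinuous for the sup norm, and
   separation of convex cones then yields a positive functional nu on bounded
   functions for which q(w) = inf_v E(v) + nu((w - v)^2) is close to E on
   finitely many given functions.  This q is a bounded quadratic form on which
   normal contractions operate; restricted to simple functions it is a
   jump-and-killing form.

   If f_n is E-Cauchy and tends to 0 in L_2(m), then L_{f_n}(h_n) -> 0 by
   energy dominance for suitable h_n, so the tails of f_n vanish in energy and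
   sup-norm closability applies to the truncations of f_n.  The Markov
   property follows by taking E-Cauchy convex combinations of contractions.
   Energy dominance also makes h |-> L_f(h) uniformly continuous for the
   L_2(m)-distance on [0,1]-valued functions in D, hence it extends to indicators
   of measurable sets; this extension is a measure dominated by m. *)

(** * Quadratic forms satisfying the parallelogram law *)

(** [X] carries no topology and [E] comes without an integral representation, so the three
    inequalities cannot be read off from [E] itself. They are linear in [E] and involve its values
    at finitely many functions only, hence approximating [E] at those functions is enough. The
    approximating form has to live beyond [D]: its jump and killing weights are its values at
    indicators of the cells of a partition, and these need not lie in [D]. An infimum over [v] in
    [D] of [E v v] plus a penalty makes sense for every bounded function. A penalty by the supremum
    norm would break the parallelogram law; [nu] of a square satisfies it, and since [nu] is
    monotone it also lets contractions operate. The infimum is not visibly quadratic, so its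
    bilinear form is recovered by polarization. The functional [nu] is produced by Zorn's lemma and
    is only finitely additive, which is all that bounded functions on finite partitions require. *)

Section Polarization.
Variables (R : realType) (V : lmodType R) (P : V -> Prop) (q : V -> R).
Hypotheses (PD : forall x y, P x -> P y -> P (x + y))
           (PZ : forall a x, P x -> P (a *: x)).
Hypothesis q_ge0 : forall x, P x -> 0 <= q x.
Hypothesis parallelogram : forall x y, P x -> P y ->
  q (x + y) + q (x - y) = 2 * q x + 2 * q y.
Hypothesis qZ : forall a x, P x -> q (a *: x) = a ^+ 2 * q x.

Definition polar x y := (q (x + y) - q (x - y)) / 4.

Let PN x : P x -> P (- x).
Proof. by move=> Px; rewrite -scaleN1r; exact: PZ. Qed.

Let PB x y : P x -> P y -> P (x - y).
Proof. by move=> Px Py; apply: PD => //; exact: PN. Qed.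

Let qN x : P x -> q (- x) = q x.
Proof. by move=> Px; rewrite -scaleN1r qZ// sqrrN expr1n mul1r. Qed.

Lemma polarC x y : P x -> P y -> polar x y = polar y x.
Proof.
by move=> Px Py; rewrite /polar [x + y]addrC -(opprB y x) qN//; exact: PB.
Qed.

Lemma quadD x y : P x -> P y -> q (x + y) = q x + q y + 2 * polar x y.
Proof. by move=> Px Py; have := parallelogram Px Py; rewrite /polar; lra. Qed.

(** The two terms of [polar] are nonnegative and add up to the parallelogram sum. This crude
    substitute for Cauchy-Schwarz makes [polar] locally bounded, which homogeneity needs. *)
Lemma polar_bound x y : P x -> P y -> `|polar x y| <= (q x + q y) / 2.
Proof.
move=> Px Py; have := parallelogram Px Py; rewrite /polar ler_norml.
have := q_ge0 (PD Px Py); have := q_ge0 (PB Px Py).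
by move=> ? ? ?; apply/andP; split; lra.
Qed.

(** The argument of Jordan and von Neumann. *)
Lemma polarDl x y z : P x -> P y -> P z -> polar (x + y) z = polar x z + polar y z.
Proof.
have dbl u : u + u = 2%:R *: u by rewrite scaler_nat mulr2n.
(* With [u = a + b] and [v = a - b], this is the difference of the parallelogram laws for the pairs
   [(a + w, b)] and [(a - w, b)]. Taking one of the two vectors zero then turns midpoints into
   sums. *)
have half u v w : P u -> P v -> P w ->
    polar u w + polar v w = 2 * polar (2^-1 *: (u + v)) w.
  move=> Pu Pv Pw; pose a := 2^-1 *: (u + v); pose b := 2^-1 *: (u - v).
  have Pa : P a by apply/PZ/PD.
  have Pb : P b by apply/PZ/PB.
  have uE : u = a + b.
    by rewrite /a /b -scalerDr addrACA subrr addr0 dbl scalerA mulVf ?scale1r.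
  have vE : v = a - b.
    by rewrite /a /b -scalerBr opprB [u + v]addrC addrACA subrr addr0 dbl scalerA mulVf ?scale1r.
  have p1 := parallelogram (PD Pa Pw) Pb.
  have p2 := parallelogram (PB Pa Pw) Pb.
  move: p1 p2; rewrite /polar -/a [in X in _ -> _ -> X]uE [in X in _ -> _ -> X]vE.
  rewrite !(addrAC a b) !(addrAC a (- b)) => p1 p2; lra.
move=> Px Py Pz; rewrite half//.
have P0 : P 0 by rewrite -(scale0r x); exact: PZ.
have := half (x + y) 0 z (PD Px Py) P0 Pz; rewrite addr0 => <-.
by rewrite [polar 0 z]/polar sub0r add0r qN// subrr mul0r addr0.
Qed.

(** The defect [d s = c s - s * c 1] is additive and vanishes at integers, so it has period one and
    is bounded; as [d (n s) = n d s] for all [n], it is zero. *)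
Lemma additive_bounded_linear (c : R -> R) (K : R) :
  (forall s t, c (s + t) = c s + c t) ->
  (forall t, `|t| <= 1 -> `|c t| <= K) -> forall t, c t = t * c 1.
Proof.
move=> cD cK t; pose d s := c s - s * c 1.
have dD a b : d (a + b) = d a + d b by rewrite /d cD; ring.
have d0 : d 0 = 0 by have := dD 0 0; rewrite addr0; lra.
have dN a : d (- a) = - d a.
  by have := dD a (- a); rewrite subrr d0; lra.
have dn s n : d (n%:R * s) = n%:R * d s.
  elim: n => [|n IH]; first by rewrite !mul0r d0.
  by rewrite -natr1 !mulrDl !mul1r dD IH.
have d1 : d 1 = 0 by rewrite /d; ring.
have dz (z : int) : d z%:~R = 0.
  case: z => n; first by rewrite -[_%:~R]mulr1 dn d1 mulr0.
  by rewrite NegzE mulrNz dN -[_%:~R]mulr1 dn d1 mulr0 oppr0.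
have K0 : 0 <= K by rewrite (le_trans _ (cK 0 _))// normr0.
have dK s : `|d s| <= K + `|c 1|.
  have -> : d s = d (s - (Num.floor s)%:~R) by rewrite dD dN dz subr0.
  set r := s - _.
  have /andP[r0 r1] : 0 <= r <= 1.
    have := floor_le_tmp s; have := lt_succ_floor s.
    by rewrite /r intrD => ? ?; apply/andP; split; lra.
  have rn : `|r| <= 1 by rewrite ger0_norm.
  rewrite /d (le_trans (ler_normB _ _))// lerD ?cK//.
  by rewrite normrM ler_piMl.
apply/eqP; rewrite -subr_eq0 -/(d t) -normr_eq0 eq_le normr_ge0 andbT.
apply/ler_addgt0Pr => e e0; rewrite add0r.
pose n := (Num.truncn ((K + `|c 1|) / e)).+1.
have n0 : (0 : R) < n%:R by rewrite ltr0n.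
have : n%:R * `|d t| <= K + `|c 1| by rewrite -(normr_nat R n) -normrM -dn.
rewrite mulrC -ler_pdivlMr// => /le_trans; apply.
rewrite ler_pdivrMr// mulrC -ler_pdivrMr// ltW// /n.
by rewrite truncnS_gt.
Qed.

Lemma polarZl a x y : P x -> P y -> polar (a *: x) y = a * polar x y.
Proof.
move=> Px Py; rewrite -[in RHS](scale1r x).
apply: (@additive_bounded_linear (fun a => polar (a *: x) y) ((q x + q y) / 2)).
  by move=> s t; rewrite scalerDl polarDl//; exact: PZ.
move=> t t1; rewrite (le_trans (polar_bound _ _))//; first exact: PZ.
rewrite qZ// ler_pM2r// lerD2r ler_piMl ?q_ge0//.
by rewrite -real_normK ?num_real// expr_le1.
Qed.

End Polarization.

(** * Separation of convex cones *)

Section PositiveFunctional.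
Variables (R : realType) (X : pointedType).
Implicit Types (u v w : X -> R) (C K : set (X -> R)).
Local Notation bdd := (@Defs.bounded_fun R X).

Lemma fctZE (a : R) u x : (a *: u) x = a * u x.
Proof. by []. Qed.

Lemma bddD u v : bdd u -> bdd v -> bdd (u + v).
Proof.
move=> [M uM] [N vN]; exists (M + N) => x.
by rewrite (le_trans (ler_normD _ _))// lerD.
Qed.

Lemma bddZ a u : bdd u -> bdd (a *: u).
Proof.
by move=> [M uM]; exists (`|a| * M) => x; rewrite normrM ler_wpM2l.
Qed.

Lemma bddN u : bdd u -> bdd (- u).
Proof. by move=> bu; rewrite -scaleN1r; exact: bddZ. Qed.

Lemma bddB u v : bdd u -> bdd v -> bdd (u - v).
Proof. by move=> bu bv; apply/bddD/bddN. Qed.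

Lemma bddM u v : bdd u -> bdd v -> bdd (fun x => u x * v x).
Proof.
move=> [M uM] [N vN]; exists (M * N) => x.
by rewrite normrM ler_pM.
Qed.

Lemma bdd_sqr u : bdd u -> bdd (fun x => u x ^+ 2).
Proof. by move=> bu; exact: (bddM bu bu). Qed.

Lemma bdd_cst (a : R) : bdd (fun _ => a).
Proof. by exists `|a|. Qed.

Lemma bdd0 : bdd 0.
Proof. by exists 0 => x; rewrite normr0. Qed.

Definition positive_functional (nu : (X -> R) -> R) :=
  [/\ (forall u v, bdd u -> bdd v -> nu (u + v) = nu u + nu v),
      (forall a u, bdd u -> nu (a *: u) = a * nu u) &
      (forall u, bdd u -> (forall x, 0 <= u x) -> 0 <= nu u)].

Lemma positive_functionalB nu u v : positive_functional nu ->
  bdd u -> bdd v -> nu (u - v) = nu u - nu v.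
Proof.
move=> [nuD nuZ _] bu bv; have -> : u - v = u + (-1) *: v by rewrite scaleN1r.
by rewrite nuD ?nuZ ?mulN1r//; exact: bddZ.
Qed.

Lemma positive_functional_le nu u v : positive_functional nu ->
  bdd u -> bdd v -> (forall x, u x <= v x) -> nu u <= nu v.
Proof.
move=> posnu bu bv uv; rewrite -subr_ge0 -positive_functionalB//.
case: posnu => _ _ nu0; by apply: nu0 => [|x]; [exact: bddB|rewrite subr_ge0].
Qed.

Definition proper_cone C :=
  [/\ (forall u v, C u -> C v -> C (u + v)),
      (forall a u, 0 <= a -> C u -> C (a *: u)) & ~ C (fun _ => -1)].

(** A maximal proper cone is a half-space; this is the separation theorem before any functional is
    available. *)
Lemma total_cone K : K 0 -> proper_cone K ->
  exists C, [/\ proper_cone C, K `<=` C & forall w, C w \/ C (- w)].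
Proof.
move=> K0 coneK.
(* The order ranges over sets [C] for which the union with [K] is a proper cone, rather than over
   cones containing [K]: the union of the empty chain is then admissible as well. *)
have [F FP totF|C [[CD CZ C1] maxC]] :=
    @Zorn_bigcup _ [set C | proper_cone (C `|` K)].
  rewrite /=; split.
  - move=> u v [[A FA Au]|Ku] [[B FB Bv]|Kv].
    + have [AB|BA] := totF _ _ FA FB.
      * have [+ _ _] := FP _ FB; move=> /(_ u v) [||Buv|]; [by left; exact: AB|by left| |by right].
        by left; exists B.
      * have [+ _ _] := FP _ FA; move=> /(_ u v) [||Buv|]; [by left|by left; exact: BA| |by right].
        by left; exists A.
    + have [+ _ _] := FP _ FA; move=> /(_ u v) [||Buv|]; [by left|by right| |by right].
      by left; exists A.
    + have [+ _ _] := FP _ FB; move=> /(_ u v) [||Buv|]; [by right|by left| |by right].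
      by left; exists B.
    + by right; have [+ _ _] := coneK; apply.
  - move=> a u a0 [[A FA Au]|Ku].
      have [_ + _] := FP _ FA; move=> /(_ a u a0) [|Buv|]; [by left| |by right].
      by left; exists A.
    by right; have [_ + _] := coneK; apply.
  - move=> [[A FA A1]|K1]; last by have [_ _ +] := coneK; apply.
    by have [_ _ +] := FP _ FA; apply; left.
pose C' := C `|` K.
have C'0 : C' 0 by right.
exists C'; split => //; first by move=> u Ku; right.
(* By maximality, adjoining a missing [w] to the cone produces the constant -1. *)
have key w : ~ C' w -> exists2 k, C' k & exists2 t, 0 <= t & k + t *: w = fun _ => -1.
  move=> nCw; pose K' := [set k + t *: w | k in C' & t in [set t | 0 <= t]].
  have C'K' : C' `<=` K'.
    by move=> k Ck; exists k => //; exists 0 => /=; rewrite // scale0r addr0.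
  have K'w : K' w by exists 0 => //; exists 1 => /=; rewrite // scale1r add0r.
  have CK' : C `<` K'.
    split; last by move=> K'C; apply: nCw; left; exact: K'C.
    by apply: subset_trans C'K'; exact: subsetUl.
  have := maxC _ CK'; rewrite /= (_ : K' `|` K = K'); last first.
    by apply/setUidPl => k Kk; apply: C'K'; right.
  have [[k Ck [t t0 kt]] _|nK] := pselect (K' (fun _ => -1)).
    by exists k => //; exists t.
  case; split => //.
  - move=> _ _ [k Ck [t t0 <-]] [l Cl [s s0 <-]]; exists (k + l); first exact: CD.
    by exists (t + s); [exact: addr_ge0|rewrite scalerDl addrACA].
  - move=> a _ a0 [k Ck [t t0 <-]]; exists (a *: k); first exact: CZ.
    by exists (a * t); [exact: mulr_ge0|rewrite scalerDr scalerA].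
move=> w; have [|nw] := pselect (C' w); first by left.
have [|nw'] := pselect (C' (- w)); first by right.
have [k Ck [t t0 kt]] := key _ nw; have [l Cl [s s0 ls]] := key _ nw'.
have [t00|tpos] := eqVneq t 0.
  by exfalso; apply: C1; rewrite -kt t00 scale0r addr0.
have tp : 0 < t by rewrite lt_neqAle eq_sym tpos.
exfalso; apply: C1.
(* If neither [w] nor [- w] belongs to the cone, then [k + t w = -1] and [l - s w = -1]; eliminating
   [w] puts -1 itself into the cone. *)
have -> : (fun _ : X => -1 : R) = (t + s)^-1 *: (s *: k + t *: l).
  have ts : t + s != 0 by rewrite gt_eqF// ltr_pwDl.
  apply/funext => x; have := congr1 (fun f => f x) kt; have := congr1 (fun f => f x) ls.
  rewrite !fctE /GRing.scale/= => lx kx.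
  have -> : s * k x + t * l x = - (t + s) by
    rewrite -[k x](addrK (t * w x)) kx -[l x](addrK (s * - w x)) lx; ring.
  by rewrite mulrN mulVf.
by apply: (CZ); [rewrite invr_ge0 addr_ge0|apply: CD; exact: CZ].
Qed.

(* In a total cone [C] containing the nonnegative functions, [nu w] is the cut
   between the [s] with [w - s] in [C] and those with [s - w] in [C]. *)
Lemma cone_functional K : proper_cone K -> (forall u, (forall x, 0 <= u x) -> K u) ->
  exists nu, [/\ positive_functional nu, nu (fun _ => 1) = 1 &
    forall w, bdd w -> K w -> 0 <= nu w].
Proof.
move=> coneK K0.
have [C [[CD CZ C1] KC totC]] := total_cone (K0 _ (fun=> lexx _)) coneK.
have cstC (a : R) : C (fun _ => a) -> 0 <= a.
  move=> Ca; rewrite leNgt; apply/negP => a0; apply: C1.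
  rewrite (_ : (fun _ => -1) = (- a^-1) *: (fun _ : X => a)); last first.
    by apply/funext => x; rewrite fctZE mulNr mulVf// lt_eqF.
  by apply: CZ => //; rewrite oppr_ge0 invr_le0 ltW.
have Cext u v : C u -> u =1 v -> C v by move=> Cu /funext <-.
(* The margin [e] is there because the cone need not be closed: the two boundary functions may fail
   to belong to it. *)
pose cut w r := forall e, 0 < e -> C ((fun _ => r + e) - w) /\ C (w - (fun _ => r - e)).
have cutP w : bdd w -> exists r, cut w r.
  move=> [M wM]; pose S := [set s | C ((fun _ => s) - w)].
  have SM : S M by apply/KC/K0 => x; rewrite subr_ge0 (le_trans (ler_norm _)).
  have Slb s : S s -> - M <= s.
    move=> Ss; have : C (((fun _ => s) - w) + (w + (fun _ => M))).
      apply: CD => //; apply/KC/K0 => x; have := wM x; rewrite ler_norml => /andP[a _].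
      by rewrite !fctE; lra.
    rewrite (_ : _ + _ = fun _ => s + M) => [/cstC|]; first lra.
    by apply/funext => x; rewrite !fctE; ring.
  have infS : has_inf S by split; [exists M|exists (- M)].
  exists (inf S) => e e0; split.
    have [s Ss sI] := inf_adherent e0 infS.
    rewrite (_ : _ - w = ((fun _ => s) - w) + (fun _ => inf S + e - s)); last first.
      by apply/funext => x; rewrite !fctE; ring.
    by apply: CD => //; apply/KC/K0 => x; rewrite subr_ge0 ltW.
  have [Cw|] := totC ((fun _ => inf S - e) - w).
    have : inf S <= inf S - e by apply: ge_inf => //; case: infS.
    by move=> ?; exfalso; lra.
  by rewrite opprB.
have cut_uniq w r s : cut w r -> cut w s -> r = s.
  wlog rs : r s / r < s.
    move=> H cr cs; have [/eqP//|] := boolP (r == s).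
    by rewrite neq_lt => /orP[rs|sr]; [exact: H|exact/esym/H].
  move=> cr cs; have e0 : 0 < (s - r) / 3 by rewrite divr_gt0// subr_gt0.
  have : 0 <= (r + (s - r) / 3) - (s - (s - r) / 3).
    have [c1 _] := cr _ e0; have [_ c2] := cs _ e0.
    apply: cstC; have c3 := CD _ _ c1 c2. apply: (Cext _ _ c3) => x.
    by rewrite !fctE; ring.
  by move=> ?; exfalso; lra.
pose nu w := xget 0 [set r | cut w r].
have nucut w : bdd w -> cut w (nu w) by move=> /cutP[r cr]; apply: xgetPex; exists r.
have nuE w r : bdd w -> cut w r -> nu w = r by move=> /nucut ?; exact: cut_uniq.
have nuD u v : bdd u -> bdd v -> nu (u + v) = nu u + nu v.
  move=> bu bv; apply: nuE => [|e e0]; first exact: bddD.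
  have e2 : 0 < e / 2 by rewrite divr_gt0.
  have [cu1 cu2] := nucut _ bu _ e2; have [cv1 cv2] := nucut _ bv _ e2; split.
    rewrite (_ : _ - _ = ((fun=> nu u + e / 2) - u) + ((fun=> nu v + e / 2) - v)).
      exact: CD.
    by apply/funext => x; rewrite !fctE; field.
  rewrite (_ : _ - _ = (u - (fun=> nu u - e / 2)) + (v - (fun=> nu v - e / 2))).
    exact: CD.
  by apply/funext => x; rewrite !fctE; field.
have nuC w : bdd w -> C w -> 0 <= nu w.
  move=> bw Cw; apply/ler_addgt0Pr => e e0.
  have := CD _ _ (nucut _ bw _ e0).1 Cw; rewrite subrK => /cstC; lra.
have nu0 w : bdd w -> (forall x, 0 <= w x) -> 0 <= nu w.
  by move=> bw w0; apply: nuC => //; exact/KC/K0.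
have nu1 : nu (fun=> 1) = 1.
  apply: nuE => [|e e0]; first exact: bdd_cst.
  by split; apply/KC/K0 => x; rewrite !fctE; lra.
have nuN w : bdd w -> nu (- w) = - nu w.
  move=> bw; apply: nuE => [|e e0]; first exact: bddN.
  have [c1 c2] := nucut _ bw _ e0; split.
    rewrite (_ : _ - _ = w - (fun=> nu w - e))//.
    by apply/funext => x; rewrite !fctE; ring.
  rewrite (_ : _ - _ = (fun=> nu w + e) - w)//.
  by apply/funext => x; rewrite !fctE; ring.
exists nu; split => //; last by move=> w bw /KC; exact: nuC.
split => // a u bu.
have [M uM] := bu.
rewrite -[in RHS](scale1r u).
(* Additivity and the bound by [M] on multiples of [u] give real homogeneity, so scalars need not be
   treated through the cone. *)
apply: (@additive_bounded_linear _ (fun a => nu (a *: u)) M) => [s t|t t1].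
  by rewrite scalerDl nuD//; exact: bddZ.
have tuM x : `|t * u x| <= M by rewrite normrM (le_trans _ (uM x))// ler_piMl.
have bt : bdd (t *: u) by exists M.
have bM : bdd (fun=> M) by exact: bdd_cst.
have nuM : nu (fun=> M) = M.
  apply: nuE => // e e0.
  by split; apply/KC/K0 => x; rewrite !fctE; lra.
have h w : bdd w -> (forall x, `|w x| <= M) -> nu w <= M.
  move=> bw wM; rewrite -subr_ge0 -[X in X - _]nuM -nuN// -nuD//; last exact: bddN.
  apply: nu0 => [|x]; first exact: bddB.
  by rewrite subr_ge0 (le_trans (ler_norm _)).
rewrite ler_norml h// andbT lerNl -nuN// h//; first exact: bddN.
by move=> x; rewrite (_ : (- _) x = - (t * u x))// normrN.
Qed.

End PositiveFunctional.

(** * Forms on which normal contractions operate *)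

Section PreDirichlet.
Variables (R : realType) (X : pointedType).
Implicit Types (u v w f g h : X -> R).
Local Notation bdd := (@Defs.bounded_fun R X).
Variables (D : set (X -> R)) (E : (X -> R) -> (X -> R) -> R).
Hypotheses (algD : bounded_algebra D) (formE : bilinear_form E D)
           (closE : supnorm_closable E D) (contrE : contractions_operate E D).

Lemma dom0 : D 0. Proof. by case: algD. Qed.

Lemma dom_add f g : D f -> D g -> D (f + g).
Proof. by case: algD => _ + _ _ _; apply. Qed.

Lemma dom_scale (a : R) f : D f -> D (a *: f).
Proof. by case: algD => _ _ + _ _; apply. Qed.

Lemma dom_mul f g : D f -> D g -> D (fun x => f x * g x).
Proof. by case: algD => _ _ _ + _; apply. Qed.

Lemma dom_opp f : D f -> D (- f).
Proof. by move=> Df; rewrite -scaleN1r; exact: dom_scale. Qed.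

Lemma dom_sub f g : D f -> D g -> D (f - g).
Proof. by move=> Df Dg; apply/dom_add/dom_opp. Qed.

Lemma dom_sqr f : D f -> D (fun x => f x ^+ 2).
Proof. by move=> Df; exact: (dom_mul Df Df). Qed.

Lemma dom_bounded f : D f -> bdd f.
Proof. by case: algD => _ _ _ _; apply. Qed.

Lemma EC f g : D f -> D g -> E f g = E g f.
Proof. by case: formE => + _ _; apply. Qed.

Lemma E_ge0 f : D f -> 0 <= E f f.
Proof. by case: formE => _ + _; apply. Qed.

Lemma E0l h : D h -> E 0 h = 0.
Proof.
move=> Dh; case: formE => _ _ /(_ 1 0 0 h dom0 dom0 Dh).
rewrite (_ : (fun _ => _) = 0 :> (X -> R)); last first.
  by apply/funext => x; rewrite mul1r; exact: addr0.
by lra.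
Qed.

Lemma EDl f g h : D f -> D g -> D h -> E (f + g) h = E f h + E g h.
Proof.
move=> Df Dg Dh; case: formE => _ _ /(_ 1 f g h Df Dg Dh).
rewrite mul1r => <-; congr E.
by apply/funext => x; rewrite mul1r.
Qed.

Lemma EZl (a : R) f h : D f -> D h -> E (a *: f) h = a * E f h.
Proof.
move=> Df Dh; case: formE => _ _ /(_ a f 0 h Df dom0 Dh).
rewrite E0l// addr0 => <-; congr E.
by apply/funext => x; exact/esym/addr0.
Qed.

Lemma EZr (a : R) f h : D f -> D h -> E f (a *: h) = a * E f h.
Proof. by move=> Df Dh; rewrite EC ?EZl ?(EC Df)//; exact: dom_scale. Qed.

Lemma EDr f g h : D f -> D g -> D h -> E h (f + g) = E h f + E h g.
Proof. by move=> Df Dg Dh; rewrite EC ?EDl ?(EC Dh)//; exact: dom_add. Qed.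

Lemma ENl f h : D f -> D h -> E (- f) h = - E f h.
Proof. by move=> Df Dh; rewrite -scaleN1r EZl// mulN1r. Qed.

Lemma ENr f h : D f -> D h -> E h (- f) = - E h f.
Proof. by move=> Df Dh; rewrite -scaleN1r EZr// mulN1r. Qed.

Lemma E_quadD f g : D f -> D g -> E (f + g) (f + g) = E f f + E g g + 2 * E f g.
Proof.
by move=> Df Dg; have ? := dom_add Df Dg; rewrite EDl// !EDr// (EC Dg Df); ring.
Qed.

Lemma E_quadB f g : D f -> D g -> E (f - g) (f - g) = E f f + E g g - 2 * E f g.
Proof.
move=> Df Dg; have ? := dom_opp Dg.
by rewrite E_quadD// !(ENl, ENr)//; ring.
Qed.

Lemma E_quadZ a f : D f -> E (a *: f) (a *: f) = a ^+ 2 * E f f.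
Proof. by move=> Df; have ? := dom_scale a Df; rewrite EZl// EZr//; ring. Qed.

Lemma E_parallelogram f g : D f -> D g ->
  E (f + g) (f + g) + E (f - g) (f - g) = 2 * E f f + 2 * E g g.
Proof. by move=> Df Dg; rewrite E_quadD// E_quadB//; ring. Qed.

Lemma E_le2 f g : D f -> D g -> E (f + g) (f + g) <= 2 * E f f + 2 * E g g.
Proof.
by move=> Df Dg; rewrite -E_parallelogram// lerDl E_ge0//; exact: dom_sub.
Qed.

Lemma dom_lipschitz (F : R -> R) (L : R) f : 0 < L -> F 0 = 0 ->
  (forall x y, `|F x - F y| <= L * `|x - y|) -> D f -> D (F \o f).
Proof.
move=> L0 F0 FL Df.
have [|Dg _] := @contrE (fun x => L^-1 * F x) _ f Df.
  split; first by rewrite F0 mulr0.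
  move=> x y; rewrite -mulrBr normrM gtr0_norm ?invr_gt0//.
  by rewrite mulrC ler_pdivrMr// mulrC.
rewrite (_ : F \o f = L *: ((fun x => L^-1 * F x) \o f)); first exact: dom_scale.
by apply/funext => x; rewrite fctZE/= mulrA mulfV ?mul1r// gt_eqF.
Qed.

(* The midpoints of near-minimisers of the energy over [K n] lie in [K n], so
   the parallelogram law makes the near-minimisers Cauchy. *)
Lemma cauchy_of_nested_convex (K : nat -> set (X -> R)) (C : R) :
  (forall n, K n `<=` D) -> (forall n k, (n <= k)%N -> K k `<=` K n) ->
  (forall n f g, K n f -> K n g -> K n (2^-1 *: (f + g))) ->
  (forall n, K n !=set0) -> (forall n f, K n f -> E f f <= C) ->
  exists2 g : nat -> X -> R, (forall n, K n (g n)) & E_cauchy E g.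
Proof.
move=> KD Kn Kmid K0 KC.
pose S n := [set E f f | f in K n].
have infS n : has_inf (S n).
  split; first by have [f Kf] := K0 n; exists (E f f), f.
  by exists 0 => _ [f /KD Df <-]; exact: E_ge0.
pose d n := inf (S n).
have dle n f : K n f -> d n <= E f f.
  by move=> Kf; apply: ge_inf; [case: (infS n)|exists f].
have d_nd n k : (n <= k)%N -> d n <= d k.
  move=> nk; apply: lb_le_inf; first by case: (infS k).
  by move=> _ [f Kf <-]; apply: dle; exact: Kn nk _ Kf.
have dC n : d n <= C.
  by have [f Kf] := K0 n; rewrite (le_trans (dle _ _ Kf))// (KC n).
have gP n : exists f, K n f /\ E f f < d n + n.+1%:R^-1.
  have [||_ [f Kf <-] fd] := @inf_adherent _ (S n) n.+1%:R^-1.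
  - by rewrite invr_gt0.
  - exact: infS.
  - by exists f.
have [g gK] := choice gP.
exists g => [n|e e0]; first by case: (gK n).
pose T := range d.
have supT : has_sup T.
  by split; [exists (d 0%N), 0%N|exists C => _ [n _ <-]].
(* The infima [d n] increase and are bounded by [C]. The midpoint of [g n] and [g k] has energy at
   least [d n], so the energy of the difference is below [2 (d k - d n) + e / 2], and
   [d k - d n < e / 8]. *)
have [|_ [N1 _ <-] N1P] := @sup_adherent _ T (e / 8) _ supT; first by rewrite divr_gt0.
have [N2 N2P] : exists N, forall n, (N <= n)%N -> (n.+1%:R^-1 : R) < e / 8.
  have e8 : 0 < e / 8 by rewrite divr_gt0.
  have [N _ NP] := near_infty_natSinv_lt (PosNum e8).
  by exists N => n /NP.
have dT n : d n <= sup T by apply: sup_upper_bound => //; exists n.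
exists (maxn N1 N2) => n k; rewrite !geq_max => /andP[n1 n2] /andP[k1 k2].
wlog nk : n k n1 n2 k1 k2 / (n <= k)%N.
  move=> H; have [nk|/ltnW kn] := leqP n k; first exact: H.
  have := H _ _ k1 k2 n1 n2 kn.
  rewrite (_ : (fun x => g k x - g n x) = - (fun x => g n x - g k x)); last first.
    by apply/funext => x; rewrite !fctE opprB.
  have DB' : D (fun x => g n x - g k x).
    by apply: (@dom_sub (g n) (g k)); apply: KD; exact: (gK _).1.
  by rewrite ENl ?ENr ?opprK//; exact: dom_opp.
have [Kgn gnd] := gK n; have [Kgk gkd] := gK k.
have {}gnd : E (g n) (g n) < d n + e / 8 by rewrite (lt_trans gnd)// ltrD2l N2P.
have {}gkd : E (g k) (g k) < d k + e / 8 by rewrite (lt_trans gkd)// ltrD2l N2P.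
have Dn := KD _ _ Kgn; have Dk := KD _ _ Kgk.
have := dle _ _ (Kmid n _ _ Kgn (Kn _ _ nk _ Kgk)).
rewrite E_quadZ; last exact: dom_add.
rewrite (_ : 2^-1 ^+ 2 = 4^-1 :> R); last by field.
have := E_parallelogram Dn Dk; have := d_nd _ _ n1; have := dT k.
rewrite -[(fun x => g n x - g k x)]/(g n - g k).
lra.
Qed.

(** * Lower semicontinuity of the energy for the supremum norm *)

Lemma supnorm_le f (M : R) : 0 <= M -> (forall x, `|f x| <= M) ->
  0 <= supnorm f <= M.
Proof.
move=> M0 fM; apply/andP; split.
  rewrite (le_trans (normr_ge0 (f point)))//; apply: ub_le_sup; last by exists point.
  by exists M => _ [x _ <-].
apply: sup_le_ub; first by exists `|f point|, point.
by move=> _ [x _ <-].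
Qed.

(** If it fails, functions of energy at most [E f f - eta] approach [f] uniformly. They form nested
    convex sets, from which an E-Cauchy sequence [g] can be chosen; closability applied to [g - f]
    forces [E (g n) (g n)] to tend to [E f f], a contradiction. *)
Lemma energy_lsc f (eta : R) : D f -> 0 < eta -> exists2 delta : R, 0 < delta &
  forall v, D v -> (forall x, `|f x - v x| <= delta) -> E f f - eta <= E v v.
Proof.
move=> Df eta0; apply: contrapT => nex.
pose K n := [set v | [/\ D v, E v v <= E f f - eta & forall x, `|f x - v x| <= n.+1%:R^-1]].
have [||||n v []|g gK gE] := @cauchy_of_nested_convex K (E f f - eta).
- by move=> n v [].
- move=> n k nk v [Dv Ev fv]; split => // x; rewrite (le_trans (fv x))//.
  by rewrite lef_pV2 ?posrE// ler_nat.
- move=> n u v [Du Eu fu] [Dv Ev fv]; split.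
  + by apply/dom_scale/dom_add.
  + rewrite E_quadZ; last exact: dom_add.
    rewrite (_ : 2^-1 ^+ 2 = 4^-1 :> R); last by field.
    by have := E_le2 Du Dv; lra.
  + move=> x; rewrite (_ : _ - _ = 2^-1 * ((f x - u x) + (f x - v x))); last first.
      by rewrite fctZE !fctE; field.
    move: (fu x) (fv x); move: (n.+1%:R^-1) => c.
    rewrite normrM (ger0_norm (x := 2^-1)) ?invr_ge0//.
    by have := ler_normD (f x - u x) (f x - v x); lra.
- move=> n; apply: contrapT => Kn0; apply: nex; exists n.+1%:R^-1; first by rewrite invr_gt0.
  move=> v Dv fv; rewrite leNgt; apply/negP => vE; apply: Kn0; exists v.
  by split => //; exact: ltW.
- by [].
have Dg n : D (g n) by case: (gK n).
have Dgf n : D (g n - f) by exact: dom_sub.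
have := @closE (fun n => g n - f) Dgf.
have cau : E_cauchy E (fun n => g n - f).
  move=> e /gE[N NP]; exists N => n k Nn Nk; have := NP _ _ Nn Nk.
  rewrite (_ : (fun x => g n x - g k x) = (fun x => (g n - f) x - (g k - f) x))//.
  by apply/funext => x; rewrite !fctE; ring.
have sup0 : supnorm (g n - f) @[n --> \oo] --> 0.
  apply: (@squeeze_cvgr _ _ _ _ (cst 0) (fun n => n.+1%:R^-1)).
  - near=> n; apply: supnorm_le => // x.
    by have [_ _] := gK n; rewrite distrC; apply.
  - exact: cvg_cst.
  - exact: cvg_harmonic.
move=> /(_ cau sup0)/cvgr0_norm_lt.
(* This threshold equals [a * (eta / 4)] for the [a] below, and [a ^+ 2 * E f f] has the same bound;
   together they stay under [a * eta]. The added 1 covers the case of zero energy. *)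
have e0 : 0 < eta ^+ 2 / (16 * (E f f + 1)).
  by rewrite divr_gt0 ?exprn_gt0// mulr_gt0// ltr_wpDl// E_ge0.
move=> /(_ _ e0)[N _ /(_ N (leqnn N))].
have [_ gf _] := gK N.
set a := eta / (4 * (E f f + 1)).
have Ef0 := E_ge0 Df.
(* [2 E(g - f, f) >= - E(g - f)/a - a E(f)] *)
have a0 : 0 < a by rewrite divr_gt0// mulr_gt0// ltr_wpDl.
have q1 := E_ge0 (dom_add (Dgf N) (dom_scale a Df)).
rewrite E_quadD// in q1; last exact: dom_scale.
rewrite E_quadZ// EZr// in q1.
have q2 := E_quadD (Dgf N) Df; rewrite subrK in q2.
rewrite ger0_norm ?E_ge0// => q3.
have aE : a * (E f f + 1) = eta / 4 by rewrite /a; field; lra.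
have q4 : E (g N - f) (g N - f) < a * (eta / 4).
  rewrite (lt_le_trans q3)// /a le_eqVlt; apply/orP; left; apply/eqP; field; lra.
have q5 : a ^+ 2 * E f f <= a * (eta / 4).
  by rewrite expr2 -mulrA ler_pM2l// -aE ler_pM2l//; lra.
have q6 : a * (2 * E (g N - f) f) <= a * (- eta).
  by rewrite ler_pM2l//; have := E_ge0 (Dgf N); lra.
have q7 : 0 < a * eta by rewrite mulr_gt0.
lra.
Unshelve. all: by end_near.
Qed.

(** * Positive functionals witnessing lower semicontinuity *)

Lemma positive_functional0 : positive_functional (fun _ : X -> R => 0).
Proof. by split => *; rewrite ?addr0 ?mulr0. Qed.

Lemma positive_functionalD nu mu : positive_functional nu ->
  positive_functional mu -> positive_functional (fun u : X -> R => nu u + mu u).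
Proof.
move=> [nuD nuZ nu0] [muD muZ mu0]; split.
- by move=> u v bu bv; rewrite nuD// muD// addrACA.
- by move=> a u bu; rewrite nuZ// muZ// mulrDr.
- by move=> u bu u0; rewrite addr_ge0 ?nu0 ?mu0.
Qed.

Lemma positive_functionalZ nu (a : R) : 0 <= a -> positive_functional nu ->
  positive_functional (fun u : X -> R => a * nu u).
Proof.
move=> a0 [nuD nuZ nu0]; split.
- by move=> u v bu bv; rewrite nuD// mulrDr.
- by move=> b u bu; rewrite nuZ//; ring.
- by move=> u bu u0; rewrite mulr_ge0 ?nu0.
Qed.

Lemma E_convex (s : R) f g : 0 <= s <= 1 -> D f -> D g ->
  E (s *: f + (1 - s) *: g) (s *: f + (1 - s) *: g) <= s * E f f + (1 - s) * E g g.
Proof.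
move=> /andP[s0 s1] Df Dg; rewrite E_quadD; [|exact: dom_scale..].
rewrite !E_quadZ// EZl ?EZr//; last exact: dom_scale.
have := E_ge0 (dom_sub Df Dg); rewrite E_quadB// => fg0.
have := mulr_ge0 (mulr_ge0 s0 (_ : 0 <= 1 - s)) fg0.
by rewrite subr_ge0 => /(_ s1); nra.
Qed.

(* Semicontinuity says that no [v] with [E v < E f - eta] satisfies
   [(f - v)^2 < delta^2] everywhere; the cone generated by the functions
   [(f - v)^2 - delta^2] and the nonnegative ones is therefore proper. *)
Lemma separating_functional f (eta : R) : D f -> 0 < eta ->
  exists2 nu, positive_functional nu & forall v, D v ->
    E f f - eta <= E v v + nu (fun x => (f x - v x) ^+ 2).
Proof.
(* When [E f f <= eta] the zero functional does. Otherwise [v = 0] has energy below [E f f - eta],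
   which puts the nonnegative functions into the cone and makes [beta] nonnegative. *)
move=> Df eta0; have [Ef0|Ef0] := leP (E f f - eta) 0.
  exists (fun=> 0); first exact: positive_functional0.
  by move=> v Dv; rewrite addr0 (le_trans Ef0)// E_ge0.
have [delta delta0 lsc] := energy_lsc Df eta0.
pose K := [set w : X -> R | exists t v, [/\ 0 <= t, D v, E v v < E f f - eta &
   forall x, t * ((f x - v x) ^+ 2 - delta ^+ 2) <= w x]].
have [||nu [posnu nu1 nuK]] := @cone_functional _ _ K.
- split.
  + move=> u1' u2' [t [v [t0 Dv Ev u1]]] [r [w [r0 Dw Ew u2]]].
    have [tr0|tr0] := eqVneq (t + r) 0.
      have ? : t = 0 by lra.
      have ? : r = 0 by lra.
      subst t r; exists 0, v; split => // x.
      by have := u1 x; have := u2 x; rewrite !mul0r fctE; lra.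
    have tr : 0 < t + r by rewrite lt_neqAle eq_sym tr0 addr_ge0.
    (* Two elements of weights [t] and [r] add up to one of weight [t + r] at the barycentre of [v]
       and [w]. Convexity of the square makes the pointwise bound survive, with the exact gain
       [s (1 - s) (v - w) ^ 2]. *)
    pose s := t / (t + r).
    have s01 : 0 <= s <= 1.
      by rewrite /s divr_ge0 ?(ltW tr)//= ler_pdivrMr// mul1r lerDl.
    have tE : t = s * (t + r) by rewrite /s divfK.
    have rE : r = (1 - s) * (t + r) by rewrite mulrBl -tE; ring.
    exists (t + r), (s *: v + (1 - s) *: w); split.
    * exact: ltW.
    * by apply: dom_add; exact: dom_scale.
    * apply: (le_lt_trans (E_convex s01 Dv Dw)).
      case/andP: s01 => s0 s1; have [->|sn0] := eqVneq s 0; first by lra.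
      have s_gt0 : 0 < s by rewrite lt_neqAle eq_sym sn0.
      have : 0 <= (1 - s) * (E f f - eta - E w w) by rewrite mulr_ge0//; lra.
      have : 0 < s * (E f f - eta - E v v) by rewrite mulr_gt0//; lra.
      by lra.
    * move=> x; have := u1 x; have := u2 x.
      rewrite [in X in X -> _]rE [in X in _ -> X -> _]tE !fctE /GRing.scale/=.
      set a := v x; set b := w x; set c := f x; move=> h1 h2.
      have := mulr_ge0 (ltW tr)
        (mulr_ge0 (mulr_ge0 (andP s01).1 (_ : 0 <= 1 - s)) (sqr_ge0 (a - b))).
      rewrite subr_ge0 => /(_ (andP s01).2).
      have -> : (t + r) * (s * (1 - s) * (a - b) ^+ 2) =
        s * (t + r) * ((c - a) ^+ 2 - delta ^+ 2) +
        (1 - s) * (t + r) * ((c - b) ^+ 2 - delta ^+ 2)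
        - (t + r) * ((c - (s * a + (1 - s) * b)) ^+ 2 - delta ^+ 2) by ring.
      lra.
  + move=> a u1' a0 [t [v [t0 Dv Ev u1]]].
    exists (a * t), v; split => //; first exact: mulr_ge0.
    by move=> x; rewrite -mulrA ler_wpM2l.
  + move=> [t [v [t0 Dv Ev H]]]; have [t00|tn0] := eqVneq t 0.
      by have := H point; rewrite t00 mul0r; lra.
    have tp : 0 < t by rewrite lt_neqAle eq_sym tn0.
    have : E f f - eta <= E v v.
      apply: lsc => // x; have := H x => Hx.
      have : (f x - v x) ^+ 2 - delta ^+ 2 <= 0.
        by rewrite -(pmulr_rle0 _ tp) (le_trans Hx)// lerN10.
      have := real_normK (num_real (f x - v x)).
      by rewrite leNgt => H1 H2; apply/negP => ?; nra.
    by rewrite leNgt Ev.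
- move=> u u0; exists 0, 0; split => //; first exact: dom0.
    by rewrite E0l//; exact: dom0.
  by move=> x; rewrite mul0r.
(* For [E v v < E f f - eta] the functional gives [(f - v) ^ 2] at least the mass [delta ^+ 2]; the
   factor [beta] turns this into [E f f - eta]. *)
pose beta := (E f f - eta) / delta ^+ 2.
have d20 : 0 < delta ^+ 2 by rewrite exprn_gt0.
have beta0 : 0 <= beta by rewrite divr_ge0 ?ltW.
exists (fun w => beta * nu w); first exact: positive_functionalZ.
move=> v Dv; have bfv : bdd (fun x => (f x - v x) ^+ 2).
  by apply: (@bdd_sqr _ _ (f - v)); apply: bddB; exact: dom_bounded.
have [_ _ nu0] := posnu.
have [Ev|Ev] := leP (E f f - eta) (E v v).
  rewrite (le_trans Ev)// lerDl mulr_ge0// nu0// => x; exact: sqr_ge0.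
have bc : bdd (fun _ : X => delta ^+ 2) by exact: bdd_cst.
have : 0 <= nu ((fun x => (f x - v x) ^+ 2) - (fun=> delta ^+ 2)).
  apply: nuK; first exact: bddB.
  by exists 1, v; split => // x; rewrite mul1r.
have nuc : nu (fun=> delta ^+ 2) = delta ^+ 2.
  rewrite (_ : (fun=> _) = delta ^+ 2 *: (fun _ : X => 1)).
    by case: posnu => _ nuZ _; rewrite nuZ ?nu1 ?mulr1//; exact: bdd_cst.
  by apply/funext => x; rewrite fctZE mulr1.
rewrite positive_functionalB// nuc subr_ge0 => H.
apply: (@le_trans _ _ (beta * delta ^+ 2)); first by rewrite /beta divfK ?gt_eqF.
by rewrite (le_trans (ler_wpM2l beta0 H))// lerDr E_ge0.
Qed.

(** Adding positive functionals only increases the right-hand sides, so the functionals of the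
    individual functions can be summed. *)
Lemma common_separating_functional (u : nat -> X -> R) n (eta : R) :
  0 < eta -> (forall i, D (u i)) ->
  exists2 nu, positive_functional nu & forall i, (i < n)%N -> forall v, D v ->
    E (u i) (u i) - eta <= E v v + nu (fun x => (u i x - v x) ^+ 2).
Proof.
move=> eta0 Du; elim: n => [|n [nu posnu nuP]].
  by exists (fun=> 0); [exact: positive_functional0|].
have [mu posmu muP] := separating_functional (Du n) eta0.
exists (fun w => nu w + mu w); first exact: positive_functionalD.
move=> i; rewrite ltnS leq_eqVlt => ni v Dv.
have b2 : bdd (fun x => (u i x - v x) ^+ 2).
  by apply: (@bdd_sqr _ _ (u i - v)); apply: bddB; exact: dom_bounded.
have [_ _ /(_ _ b2) nu0] := posnu; have [_ _ /(_ _ b2) mu0] := posmu.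
have {}nu0 := nu0 (fun=> sqr_ge0 _); have {}mu0 := mu0 (fun=> sqr_ge0 _).
case/orP: ni => [/eqP ?|/nuP /(_ v Dv)]; last lra.
by subst i; have := muP _ Dv; lra.
Qed.

(* Moreau-Yosida regularisation of [E] for the seminorm [w |-> nu (w^2)]. *)
Definition envelope (nu : (X -> R) -> R) w :=
  inf [set E v v + nu (fun x => (w x - v x) ^+ 2) | v in D].

Section Envelope.
Variable nu : (X -> R) -> R.
Hypothesis posnu : positive_functional nu.
Local Notation q := (envelope nu).

Let bsub w v : bdd w -> D v -> bdd (fun x => (w x - v x) ^+ 2).
Proof. by move=> bw Dv; apply: (@bdd_sqr _ _ (w - v)); apply/bddB/dom_bounded. Qed.

Let term_ge0 w v : bdd w -> D v -> 0 <= E v v + nu (fun x => (w x - v x) ^+ 2).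
Proof.
move=> bw Dv; rewrite addr_ge0 ?E_ge0//; case: posnu => _ _; apply.
  exact: bsub.
by move=> x; exact: sqr_ge0.
Qed.

Let has_inf_envelope w : bdd w ->
  has_inf [set E v v + nu (fun x => (w x - v x) ^+ 2) | v in D].
Proof.
move=> bw; split; first by eexists; exists 0; [exact: dom0|reflexivity].
by exists 0 => _ [v Dv <-]; exact: term_ge0.
Qed.

Lemma envelope_le w v : bdd w -> D v -> q w <= E v v + nu (fun x => (w x - v x) ^+ 2).
Proof.
by move=> bw Dv; apply: ge_inf; [case: (has_inf_envelope bw)|exists v].
Qed.

Lemma envelope_ge w c : bdd w ->
  (forall v, D v -> c <= E v v + nu (fun x => (w x - v x) ^+ 2)) -> c <= q w.
Proof.
move=> bw H; apply: lb_le_inf; first by case: (has_inf_envelope bw).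
by move=> _ [v Dv <-]; exact: H.
Qed.

Lemma envelope_ge0 w : bdd w -> 0 <= q w.
Proof. by move=> bw; apply: envelope_ge => // v; exact: term_ge0. Qed.

Lemma envelope_le_E f : D f -> q f <= E f f.
Proof.
move=> Df; rewrite (le_trans (envelope_le (dom_bounded Df) Df))// gerDl.
rewrite (_ : (fun x => _) = 0 *: (fun _ : X => (0 : R))).
  by case: posnu => _ nuZ _; rewrite nuZ ?mul0r//; exact: bdd_cst.
by apply/funext => x; rewrite subrr expr0n fctZE mulr0.
Qed.

(** The competitor [v = 0]. This is what makes the polar form continuous for the supremum norm. *)
Lemma envelope_bound w (M : R) : (forall x, `|w x| <= M) ->
  q w <= M ^+ 2 * nu (fun=> 1).
Proof.
move=> wM; have bw : bdd w by exists M.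
rewrite (le_trans (envelope_le bw dom0))// E0l ?add0r; last exact: dom0.
case: (posnu) => _ nuZ _; rewrite -nuZ; last exact: bdd_cst.
apply: positive_functional_le => //; first exact: (bsub bw dom0).
  by apply: bddZ; exact: bdd_cst.
move=> x; rewrite fctZE mulr1 (_ : w x - _ = w x); last exact: subr0.
rewrite -real_normK ?num_real// ler_pXn2r// ?nnegrE//.
by rewrite (le_trans (normr_ge0 (w x))).
Qed.

(** Contracting a competitor [v] along with [w] lowers its energy by hypothesis and the penalty
    pointwise. *)
Lemma envelope_contraction F w : normal_contraction F -> bdd w -> q (F \o w) <= q w.
Proof.
move=> cF bw; apply: envelope_ge => // v Dv.
have bFw : bdd (F \o w).
  have [F0 FL] := cF; have [M wM] := bw; exists M => x /=.
  by rewrite (le_trans _ (wM x))// -[X in `|X|]subr0 -F0 (le_trans (FL _ _))// subr0.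
have [DFv EFv] := contrE cF Dv.
rewrite (le_trans (envelope_le bFw DFv))// lerD//.
apply: positive_functional_le => //; [exact: bsub..|].
move=> x; rewrite -[leLHS]real_normK ?num_real// -[leRHS]real_normK ?num_real//.
by rewrite ler_pXn2r ?nnegrE//; case: cF => _; apply.
Qed.

Let envelope_parallelogram_le v w : bdd v -> bdd w ->
  q (v + w) + q (v - w) <= 2 * q v + 2 * q w.
Proof.
move=> bv bw.
suff H a : D a -> q (v + w) + q (v - w) <= 2 * (E a a + nu (fun x => (v x - a x) ^+ 2)) + 2 * q w.
  suff : (q (v + w) + q (v - w) - 2 * q w) / 2 <= q v by lra.
  by apply: envelope_ge => // a /H; lra.
move=> Da.
suff : (q (v + w) + q (v - w) - 2 * (E a a + nu (fun x => (v x - a x) ^+ 2))) / 2 <= q w by lra.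
apply: envelope_ge => // b Db.
(* Competitors [a] for [v] and [b] for [w] yield [a + b] and [a - b] for the sum and the difference;
   the energy and the penalty each satisfy the parallelogram law. *)
have h1 := envelope_le (bddD bv bw) (dom_add Da Db).
have h2 := envelope_le (bddB bv bw) (dom_sub Da Db).
have := E_parallelogram Da Db.
suff : nu (fun x => ((v + w) x - (a + b) x) ^+ 2) + nu (fun x => ((v - w) x - (a - b) x) ^+ 2)
  = 2 * nu (fun x => (v x - a x) ^+ 2) + 2 * nu (fun x => (w x - b x) ^+ 2) by lra.
have [nuD nuZ _] := posnu.
have ba := bsub bv Da; have bb := bsub bw Db.
rewrite -!nuZ// -!nuD//.
- congr nu; apply/funext => x; rewrite !fctE /GRing.scale/=; ring.
- exact: bddZ.
- exact: bddZ.
- exact: (bsub (bddD bv bw) (dom_add Da Db)).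
- exact: (bsub (bddB bv bw) (dom_sub Da Db)).
Qed.

Let envelopeZ_le a w : bdd w -> q (a *: w) <= a ^+ 2 * q w.
Proof.
move=> bw; have [->|a0] := eqVneq a 0.
  rewrite scale0r expr0n mul0r (le_trans (@envelope_bound 0 0 _))//.
    by move=> x; rewrite normr0.
  by rewrite expr0n mul0r.
have a2 : 0 < a ^+ 2 by rewrite exprn_even_gt0//= a0.
rewrite -ler_pdivrMl//; apply: envelope_ge => // v Dv.
rewrite ler_pdivrMl// (le_trans (envelope_le (bddZ _ bw) (dom_scale a Dv)))//.
rewrite E_quadZ// mulrDr lerD2l; case: (posnu) => _ nuZ _.
rewrite -nuZ; last exact: bsub.
rewrite le_eqVlt; apply/orP; left; apply/eqP; congr nu.
by apply/funext => x; rewrite !fctE /GRing.scale/=; ring.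
Qed.

Lemma envelopeZ a w : bdd w -> q (a *: w) = a ^+ 2 * q w.
Proof.
move=> bw; apply/eqP; rewrite eq_le envelopeZ_le//=.
have [->|a0] := eqVneq a 0.
  by rewrite expr0n mul0r envelope_ge0//; exact: bddZ.
have := envelopeZ_le a^-1 (bddZ a bw).
rewrite scalerA mulVf// scale1r exprVn ler_pdivlMl//.
by rewrite exprn_even_gt0//= a0.
Qed.

(** The inequality already proved, applied to [v + w] and [v - w], is the reverse inequality after
    rescaling by 2. *)
Lemma envelope_parallelogram v w : bdd v -> bdd w ->
  q (v + w) + q (v - w) = 2 * q v + 2 * q w.
Proof.
move=> bv bw; apply/eqP; rewrite eq_le envelope_parallelogram_le//=.
have := envelope_parallelogram_le (bddD bv bw) (bddB bv bw).
have -> : v + w + (v - w) = 2 *: v by apply/funext => x; rewrite fctZE !fctE; ring.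
have -> : v + w - (v - w) = 2 *: w by apply/funext => x; rewrite fctZE !fctE; ring.
rewrite !envelopeZ//; lra.
Qed.

End Envelope.

(* [b] is the matrix of a jump-and-killing form: by symmetry
   [\sum b c = \sum_t c t t * (row sum of b) - \sum_(t, s) b t s *
   (c t t + c s s - c t s - c s t) / 2]. *)
Lemma jump_sum_ge0 (T : finType) (b c : T -> T -> R) :
  (forall t s, b t s = b s t) -> (forall t s, t != s -> b t s <= 0) ->
  (forall t, 0 <= \sum_s b t s) -> (forall t, 0 <= c t t) ->
  (forall t s, 0 <= c t t + c s s - c t s - c s t) ->
  0 <= \sum_t \sum_s b t s * c t s.
Proof.
move=> bC b_le0 b_ge0 c0 cJ.
have E1 : \sum_t \sum_s b t s * c t s = \sum_t \sum_s b t s * c s t.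
  by rewrite exchange_big/=; apply: eq_bigr => t _; apply: eq_bigr => s _; rewrite bC.
have E2 : \sum_t \sum_s b t s * c t t = \sum_t \sum_s b t s * c s s.
  by rewrite exchange_big/=; apply: eq_bigr => t _; apply: eq_bigr => s _; rewrite bC.
have diag : 0 <= \sum_t \sum_s b t s * c t t.
  by apply: sumr_ge0 => t _; rewrite -mulr_suml mulr_ge0.
have off : 0 <= \sum_t \sum_s - b t s * (c t t + c s s - c t s - c s t).
  apply: sumr_ge0 => t _; apply: sumr_ge0 => s _.
  have [->|ts] := eqVneq t s; last by rewrite mulr_ge0// oppr_ge0 b_le0.
  by rewrite (_ : _ - _ = 0) ?mulr0//; ring.
have : \sum_t \sum_s - b t s * (c t t + c s s - c t s - c s t) =
    (\sum_t \sum_s b t s * c t s + \sum_t \sum_s b t s * c s t) -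
    (\sum_t \sum_s b t s * c t t + \sum_t \sum_s b t s * c s s).
  rewrite -!big_split/= -sumrB; apply: eq_bigr => t _.
  by rewrite -!big_split/= -sumrB; apply: eq_bigr => s _; ring.
rewrite -E1 -E2; lra.
Qed.

Lemma quantize (u : nat -> X -> R) n (eps : R) : 0 < eps -> (forall i, bdd (u i)) ->
  exists (T : finType) (e : X -> T), forall i, (i < n)%N -> forall x y, e x = e y ->
    `|u i x - u i y| <= eps.
Proof.
move=> eps0 bu; elim: n => [|n [T [e eP]]]; first by exists unit, (fun=> tt).
have [M uM] := bu n.
pose k x := Num.truncn ((u n x + M) / eps).
have uM0 x : 0 <= u n x + M by have := uM x; rewrite ler_norml => /andP[]; lra.
have kx x : (k x < (Num.truncn (2 * M / eps)).+1)%N.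
  rewrite ltnS /k; apply: le_truncn; rewrite ler_pM2r ?invr_gt0//.
  by have := uM x; rewrite ler_norml => /andP[]; lra.
exists (T * 'I_(Num.truncn (2 * M / eps)).+1)%type, (fun x => (e x, Ordinal (kx x))).
move=> i + x y [exy kxy]; rewrite ltnS leq_eqVlt => /orP[/eqP ->|ni]; last exact: eP.
have /truncn_itv/andP[x1 x2] : 0 <= (u n x + M) / eps by rewrite divr_ge0// ltW.
have /truncn_itv/andP[y1 y2] : 0 <= (u n y + M) / eps by rewrite divr_ge0// ltW.
rewrite -/(k x) kxy in x1 x2; rewrite -/(k y) in y1 y2.
rewrite -natr1 in x2 y2; move: x1 x2 y1 y2; move: ((k y)%:R : R) => K.
rewrite !(ler_pdivlMr, ltr_pdivrMr)// => x1 x2 y1 y2.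
by rewrite ler_norml; apply/andP; split; lra.
Qed.

(** * The envelope as a jump-and-killing form on finite partitions *)

Section Transfer.
Variable nu : (X -> R) -> R.
Hypothesis posnu : positive_functional nu.
Local Notation B := (polar (envelope nu)).
Local Notation q := (envelope nu).

Let BC u v : bdd u -> bdd v -> B u v = B v u.
Proof. exact: (polarC (@bddD R X) (@bddZ R X) (envelopeZ posnu)). Qed.

Let BDl u v w : bdd u -> bdd v -> bdd w -> B (u + v) w = B u w + B v w.
Proof.
exact: (polarDl (@bddD R X) (@bddZ R X) (envelope_parallelogram posnu) (envelopeZ posnu)).
Qed.

Let BZl a u v : bdd u -> bdd v -> B (a *: u) v = a * B u v.
Proof.
exact: (polarZl (@bddD R X) (@bddZ R X) (envelope_ge0 posnu)
  (envelope_parallelogram posnu) (envelopeZ posnu)).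
Qed.

Let BNl u v : bdd u -> bdd v -> B (- u) v = - B u v.
Proof. by move=> bu bv; rewrite -scaleN1r BZl// mulN1r. Qed.

Let Bsuml (I : Type) (r : seq I) (a : I -> R) (w : I -> X -> R) v :
  (forall i, bdd (w i)) -> bdd v ->
  B (\sum_(i <- r) a i *: w i) v = \sum_(i <- r) a i * B (w i) v.
Proof.
move=> bw bv; apply: (proj2 (A := bdd (\sum_(i <- r) a i *: w i))).
apply: (big_rec2 (fun x y => bdd x /\ B x v = y)).
  split; first exact: bdd0.
  by rewrite -(scale0r v) BZl// mul0r.
move=> i y1 y2 _ [b1 <-]; have bi := bddZ (a i) (bw i); split; first exact: bddD.
by rewrite BDl// BZl.
Qed.

Let Bsumr (I : Type) (r : seq I) (a : I -> R) (w : I -> X -> R) v :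
  (forall i, bdd (w i)) -> bdd v ->
  B v (\sum_(i <- r) a i *: w i) = \sum_(i <- r) a i * B v (w i).
Proof.
move=> bw bv; rewrite BC//; last first.
  elim/big_ind: _ => [|*|*]; [exact: bdd0|exact: bddD|exact: bddZ].
by rewrite Bsuml//; apply: eq_bigr => i _; rewrite BC.
Qed.

Section SimpleFunctions.
Variables (T : finType) (e : X -> T).
Let ind t : X -> R := fun x => (e x == t)%:R.

Let bind t : bdd (ind t).
Proof. by exists 1 => x; rewrite /ind; case: (_ == _); rewrite ?normr1 ?normr0. Qed.

Let simpleE (u : T -> R) : (fun x => u (e x)) = \sum_t u t *: ind t.
Proof.
apply/funext => x; rewrite fct_sumE (bigD1 (e x))//= big1 ?addr0.
  by rewrite fctZE /ind eqxx mulr1.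
by move=> t te; rewrite fctZE /ind eq_sym (negbTE te) mulr0.
Qed.

Lemma polar_simple (u v : T -> R) : B (fun x => u (e x)) (fun x => v (e x)) =
  \sum_t \sum_s B (ind t) (ind s) * (u t * v s).
Proof.
have bsum : bdd (\sum_t v t *: ind t).
  elim/big_ind: _ => [|*|*]; [exact: bdd0|exact: bddD|exact: bddZ].
rewrite !simpleE Bsuml//; apply: eq_bigr => t _.
rewrite Bsumr// mulr_sumr; apply: eq_bigr => s _; ring.
Qed.

(** The absolute value is a normal contraction and maps the difference of two disjoint indicators to
    their sum. *)
Lemma polar_ind_le0 t s : t != s -> B (ind t) (ind s) <= 0.
Proof.
move=> ts; rewrite /polar pmulr_lle0 ?invr_gt0// subr_le0.
have -> : ind t + ind s = (fun x => `|x|) \o (ind t - ind s).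
  apply/funext => x; rewrite /= !fctE /ind.
  have [->|_] := eqVneq (e x) t; first by rewrite (negbTE ts) subr0 addr0 normr1.
  by case: (_ == _); rewrite sub0r add0r normrN ?normr1 ?normr0.
apply: (envelope_contraction posnu); last exact: bddB.
by split; [exact: normr0|exact: ler_dist_dist].
Qed.

(** The row sum is the polar form of [ind t] with the constant 1. Truncation at 1 maps
    [1 + a * ind t] to 1 for [a > 0], so the energy cannot decrease when [a * ind t] is added; the
    first order in [a] gives the sign. *)
Lemma polar_ind_row t : 0 <= \sum_s B (ind t) (ind s).
Proof.
have -> : \sum_s B (ind t) (ind s) = B (ind t) (fun=> 1).
  rewrite (simpleE (fun=> 1)) Bsumr//; apply: eq_bigr => s _; by rewrite mul1r.
have b1 : bdd (fun _ : X => (1 : R)) by exact: bdd_cst.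
have key a : 0 < a -> 0 <= 2 * B (ind t) (fun=> 1) + a * q (ind t).
  move=> a0; have ba := bddZ a (bind t).
  have := envelope_contraction posnu (F := fun x => Num.min x 1) _ (bddD ba b1).
  rewrite (_ : _ \o _ = fun=> 1); last first.
    apply/funext => x /=; apply/min_idPr; rewrite !fctE lerDr.
    by rewrite mulr_ge0 ?ler0n ?ltW.
  rewrite (quadD (envelope_parallelogram posnu))// envelopeZ// BZl//.
  have nc : normal_contraction (fun x : R => Num.min x 1).
    split; first by apply/min_idPl.
    by move=> x y; rewrite /Num.min; do 2 case: ltP => ?;
      rewrite ler_norml; have := ler_norm (x - y); have := ler_norm (y - x);
      rewrite (distrC y x) => ? ?; apply/andP; split; lra.
  move=> /(_ nc) H; rewrite -(pmulr_rge0 _ a0); lra.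
rewrite leNgt; apply/negP => neg.
have q0 : 0 <= q (ind t) by exact: envelope_ge0.
(* With this [a], [2 B + a q = B - a], which is negative when [B] is. *)
pose a := - B (ind t) (fun=> 1) / (q (ind t) + 1).
have a0 : 0 < a by rewrite divr_gt0 ?oppr_gt0// ltr_wpDl.
have := key _ a0.
have : a * (q (ind t) + 1) = - B (ind t) (fun=> 1) by rewrite /a divfK// gt_eqF// ltr_wpDl.
lra.
Qed.

End SimpleFunctions.

Let B_small u v (eps M : R) : 0 < eps -> (forall x, `|u x| <= eps) ->
  (forall x, `|v x| <= M) -> `|B u v| <= eps * ((1 + M ^+ 2) * nu (fun=> 1) / 2).
Proof.
move=> eps0 ue vM.
have bu : bdd u by exists eps.
have bv : bdd v by exists M.
have -> : u = eps *: (eps^-1 *: u) by rewrite scalerA mulfV ?scale1r// gt_eqF.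
have beu := bddZ eps^-1 bu.
rewrite BZl// normrM gtr0_norm// ler_pM2l//.
rewrite (le_trans (polar_bound (@bddD R X) (@bddZ R X) (envelope_ge0 posnu)
  (envelope_parallelogram posnu) _ _))// ler_pM2r ?invr_gt0// mulrDl.
rewrite lerD ?envelope_bound// -[X in X * _](expr1n _ 2).
apply: (envelope_bound posnu) => x.
by rewrite fctZE normrM gtr0_norm ?invr_gt0// mulrC ler_pdivrMr// mul1r.
Qed.

(* Replacing all functions by their values at one sample point per cell of a
   fine finite partition keeps the two pointwise hypotheses exactly, and turns
   [B] into a jump-and-killing form on a finite set. *)
Lemma envelope_transfer (s a : R) f h g : bdd f -> bdd h -> bdd g ->
  (forall x y, 0 <= s * ((f x - f y) ^+ 2 * (h x + h y)) + a * (g x - g y) ^+ 2) ->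
  (forall x, 0 <= s * (f x ^+ 2 * h x) + a * g x ^+ 2) ->
  0 <= s * (2 * B (fun x => f x * h x) f - B (fun x => f x ^+ 2) h) + a * B g g.
Proof.
move=> bf bh bg jump kill.
(* All arguments of the form that occur in the conclusion, products included, so that a single
   partition serves them all. *)
pose u := fun i : nat => nth (fun _ : X => (0 : R))
  [:: f; h; g; (fun x => f x * h x); (fun x => f x ^+ 2)] i.
have bu i : bdd (u i).
  rewrite /u; case: i => [|[|[|[|[|i]]]]] //=; [exact: bddM|exact: bdd_sqr|].
  by rewrite nth_nil; exact: bdd_cst.
have [M uM] : exists M, forall i, (i < 5)%N -> forall x, `|u i x| <= M.
  elim: 5%N => [|n [M uM]]; first by exists 0.
  have [N uN] := bu n; exists (Num.max M N) => i.
  rewrite ltnS leq_eqVlt => /orP[/eqP ->|/uM uiM] x; rewrite le_max.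
    by rewrite uN orbT.
  by rewrite uiM.
pose c := (1 + M ^+ 2) * nu (fun=> 1) / 2.
have c0 : 0 <= c.
  rewrite divr_ge0// mulr_ge0//; first by rewrite addr_ge0// sqr_ge0.
  by case: posnu => _ _; apply => //; exact: bdd_cst.
(* Sampling changes each value of [B] by at most [2 * d * c]. The factor [s] meets three such
   values, the factor [a] one; the final 1 keeps [C] positive. *)
pose C := 6 * `|s| * c + 2 * `|a| * c + 1.
have C0 : 0 < C.
  by have := mulr_ge0 (normr_ge0 s) c0; have := mulr_ge0 (normr_ge0 a) c0; rewrite /C; lra.
apply/ler_addgt0Pr => eps eps0; rewrite -lerBlDr sub0r.
pose d := eps / C; have d0 : 0 < d by rewrite divr_gt0.
have [T [e eP]] := quantize 5 d0 bu.
pose r t := xget point [set x | e x = t].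
have er x : e (r (e x)) = e x by apply: (@xgetPex _ point [set y | e y = e x]); exists x.
pose u' i := fun x => u i (r (e x)).
have bu' i : bdd (u' i) by have [N uN] := bu i; exists N => x; exact: uN.
have close i j : (i < 5)%N -> (j < 5)%N -> `|B (u i) (u j) - B (u' i) (u' j)| <= 2 * d * c.
  move=> i5 j5.
  have -> : B (u i) (u j) - B (u' i) (u' j) = B (u i - u' i) (u j) + B (u j - u' j) (u' i).
    rewrite !BDl ?BNl ?(BC (bu j) (bu' i)) ?(BC (bu' j) (bu' i))//;
      [ring|exact: bddN..].
  rewrite (le_trans (ler_normD _ _))// (_ : 2 * d * c = d * c + d * c); last by ring.
  rewrite lerD// B_small// => x; try exact: uM; try exact: (eP _ _ x _ (esym (er x))).
have main : 0 <= s * (2 * B (u' 3%N) (u' 0%N) - B (u' 4%N) (u' 1%N)) + a * B (u' 2%N) (u' 2%N).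
  pose F t := f (r t); pose H t := h (r t); pose G t := g (r t).
  rewrite (polar_simple e (fun t => F t * H t) F) (polar_simple e (fun t => F t ^+ 2) H).
  rewrite (polar_simple e G G).
  (* On the diagonal [k] is the killing integrand, and [k t t + k s s - k t s - k s t] is the jump
     integrand; these are the two signs that [jump_sum_ge0] asks for. *)
  pose k t1 t2 := s * (2 * (F t1 * H t1 * F t2) - F t1 ^+ 2 * H t2) + a * (G t1 * G t2).
  set b := fun t1 t2 => B (fun x => (e x == t1)%:R) (fun x => (e x == t2)%:R).
  rewrite [X in 0 <= X](_ : _ = \sum_t1 \sum_t2 b t1 t2 * k t1 t2); last first.
    rewrite !mulr_sumr -sumrB mulr_sumr -big_split/=; apply: eq_bigr => t1 _.
    rewrite !mulr_sumr -sumrB mulr_sumr -big_split/=; apply: eq_bigr => t2 _.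
    rewrite /b /k; ring.
  apply: jump_sum_ge0.
  - move=> t1 t2; apply: BC; exists 1 => x;
      by case: (_ == _); rewrite ?normr1 ?normr0.
  - by move=> t1 t2; exact: polar_ind_le0.
  - by move=> t1; exact: polar_ind_row.
  - move=> t; have := kill (r t).
    by rewrite /k /F /H /G; congr (0 <= _); ring.
  - move=> t1 t2; have := jump (r t1) (r t2).
    by rewrite /k /F /H /G; congr (0 <= _); ring.
have := close 3%N 0%N isT isT; have := close 4%N 1%N isT isT; have := close 2%N 2%N isT isT.
rewrite -[B (fun x => f x * h x) f]/(B (u 3%N) (u 0%N)).
rewrite -[B (fun x => f x ^+ 2) h]/(B (u 4%N) (u 1%N)) -[B g g]/(B (u 2%N) (u 2%N)).
have dC : d * C = eps by rewrite /d divfK// gt_eqF.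
move: main; set x1 := B (u' _) _; set x2 := B (u' _) _; set x3 := B (u' _) _.
set y1 := B _ _; set y2 := B _ _; set y3 := B _ _ => main d3 d2 d1.
have e1 : `|s * (y3 - x1)| <= `|s| * (2 * d * c) by rewrite normrM ler_wpM2l.
have e2 : `|s * (y2 - x2)| <= `|s| * (2 * d * c) by rewrite normrM ler_wpM2l.
have e3 : `|a * (y1 - x3)| <= `|a| * (2 * d * c) by rewrite normrM ler_wpM2l.
move: e1 e2 e3; rewrite !ler_norml => /andP[e1 _] /andP[_ e2] /andP[e3 _].
by rewrite -dC /C; lra.
Qed.

End Transfer.

(** In a jump-and-killing form, [Lfun E f h] has jump integrand [(f x - f y) ^ 2 * (h x + h y)] and
    killing integrand [f x ^ 2 * h x], against the weights that give [E g g] the integrands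
    [(g x - g y) ^ 2] and [g x ^ 2]. Linear inequalities between the two may thus be checked
    pointwise. *)
Lemma E_transfer (s a : R) f h g : D f -> D h -> D g ->
  (forall x y, 0 <= s * ((f x - f y) ^+ 2 * (h x + h y)) + a * (g x - g y) ^+ 2) ->
  (forall x, 0 <= s * (f x ^+ 2 * h x) + a * g x ^+ 2) ->
  0 <= s * Defs.Lfun E f h + a * E g g.
Proof.
move=> Df Dh Dg jump kill.
pose u := fun i : nat => nth (fun _ : X => (0 : R))
  [:: f; h; g; (fun x => f x * h x); (fun x => f x ^+ 2)] i.
have Du i : D (u i).
  rewrite /u; case: i => [|[|[|[|[|i]]]]] //=; [exact: dom_mul|exact: dom_sqr|].
  by rewrite nth_nil; exact: dom0.
pose C := 3 * `|s| + `|a| + 1.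
have C0 : 0 < C by have := normr_ge0 s; have := normr_ge0 a; rewrite /C; lra.
apply/ler_addgt0Pr => eps eps0; rewrite -lerBlDr sub0r.
pose eta := eps / C; have eta0 : 0 < eta by rewrite divr_gt0.
have [nu posnu nuP] := common_separating_functional 5 eta0 Du.
(* The lower bound on the envelope is available only at the listed functions, but [envelope_le_E]
   holds at their sums and differences too; expanding both quadratic forms there bounds the polar
   forms from both sides. *)
have close i j : (i < 5)%N -> (j < 5)%N ->
    `|E (u i) (u j) - polar (envelope nu) (u i) (u j)| <= eta.
  move=> i5 j5; have bi := dom_bounded (Du i); have bj := dom_bounded (Du j).
  have qi : E (u i) (u i) - eta <= envelope nu (u i).
    by apply: (envelope_ge posnu) => // v; exact: nuP.
  have qj : E (u j) (u j) - eta <= envelope nu (u j).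
    by apply: (envelope_ge posnu) => // v; exact: nuP.
  have := envelope_le_E posnu (dom_add (Du i) (Du j)).
  have := envelope_le_E posnu (dom_sub (Du i) (Du j)).
  have := envelope_parallelogram posnu bi bj.
  rewrite (quadD (envelope_parallelogram posnu) bi bj).
  rewrite (E_quadD (Du i) (Du j)) (E_quadB (Du i) (Du j)) => p1 p2 p3.
  by rewrite ler_norml; apply/andP; split; lra.
have := envelope_transfer posnu (dom_bounded Df) (dom_bounded Dh) (dom_bounded Dg) jump kill.
have := close 3%N 0%N isT isT; have := close 4%N 1%N isT isT; have := close 2%N 2%N isT isT.
rewrite /u /= /Defs.Lfun.
set x1 := polar _ _ _; set x2 := polar _ _ _; set x3 := polar _ _ _.
set y1 := E _ _; set y2 := E _ _; set y3 := E _ _ => d3 d2 d1 main.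
have e1 : `|s * (y3 - x3)| <= `|s| * eta by rewrite normrM ler_wpM2l.
have e2 : `|s * (y2 - x2)| <= `|s| * eta by rewrite normrM ler_wpM2l.
have e3 : `|a * (y1 - x1)| <= `|a| * eta by rewrite normrM ler_wpM2l.
have dC : eta * C = eps by rewrite /eta divfK// gt_eqF.
move: e1 e2 e3; rewrite !ler_norml => /andP[e1 _] /andP[_ e2] /andP[e3 _].
by rewrite -dC /C; lra.
Qed.

Lemma L_ge0 f h : D f -> D h -> (forall x, 0 <= h x) -> 0 <= Defs.Lfun E f h.
Proof.
move=> Df Dh h0; have := @E_transfer 1 0 f h 0 Df Dh dom0.
rewrite !mul1r !mul0r addr0; apply => [x y|x]; rewrite !mul0r addr0 mul1r.
  by rewrite mulr_ge0 ?sqr_ge0// addr_ge0.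
by rewrite mulr_ge0 ?sqr_ge0.
Qed.

(** The factor 2 comes from the jump part, where [h x + h y] may reach 2. *)
Lemma L_le f h : D f -> D h -> (forall x, h x <= 1) -> Defs.Lfun E f h <= 2 * E f f.
Proof.
move=> Df Dh h1; have := @E_transfer (- 1) 2 f h f Df Dh Df.
rewrite mulN1r addrC subr_ge0; apply => [x y|x]; rewrite mulN1r addrC subr_ge0.
  by rewrite mulrC ler_wpM2r ?sqr_ge0//; have := h1 x; have := h1 y; lra.
by rewrite mulrC ler_wpM2r ?sqr_ge0// (le_trans (h1 x))// ler1n.
Qed.

Lemma E_le_L f g h : D f -> D g -> D h ->
  (forall x y, (g x - g y) ^+ 2 <= (f x - f y) ^+ 2 * (h x + h y)) ->
  (forall x, g x ^+ 2 <= f x ^+ 2 * h x) -> E g g <= Defs.Lfun E f h.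
Proof.
move=> Df Dg Dh jump kill; have := @E_transfer 1 (- 1) f h g Df Dh Dg.
rewrite mulN1r mul1r subr_ge0; apply => [x y|x]; rewrite mul1r mulN1r subr_ge0.
  exact: jump.
exact: kill.
Qed.

End PreDirichlet.

Lemma cvge0P (R : realType) (u : nat -> \bar R) : (forall n, (0 <= u n)%E) ->
  u n @[n --> \oo] --> 0%E <->
  forall e : R, 0 < e -> exists N, forall n, (N <= n)%N -> (u n < e%:E)%E.
Proof.
move=> u0; split => [cu e e0|H].
  have [|N _ NP] := cu [set x | (x < e%:E)%E]; last by exists N => n /NP.
  by apply: open_ereal_lt'; rewrite lte_fin.
apply/fine_cvgP; split.
  have [N NP] := H 1 ltr01; exists N => // n /NP un.
  by rewrite ge0_fin_numE// (lt_trans un) ?ltry.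
apply/cvgr0Pnorm_lt => e e0; have [N NP] := H e e0; exists N => // n /NP un /=.
rewrite ger0_norm ?fine_ge0// -lte_fin fineK// ge0_fin_numE//.
by rewrite (lt_trans un) ?ltry.
Qed.

(** * Square integrals *)

Section SquareIntegral.
Context d (T : measurableType d) (R : realType) (m : {finite_measure set T -> \bar R}).
Implicit Types (u v : T -> R) (A : set T).

Definition sqint u : \bar R := (\int[m]_x ((u x) ^+ 2)%:E)%E.

Lemma sqint_measurable u : measurable_fun setT u ->
  measurable_fun setT (fun x => (u x ^+ 2)%:E : \bar R).
Proof. by move=> mu; apply/measurable_EFinP; exact: measurable_funX. Qed.

Lemma sqint_ge0 u : (0 <= sqint u)%E.
Proof. by apply: integral_ge0 => x _; rewrite lee_fin sqr_ge0. Qed.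

Lemma sqint_le u v : measurable_fun setT u -> measurable_fun setT v ->
  (forall x, `|u x| <= `|v x|) -> (sqint u <= sqint v)%E.
Proof.
move=> mu mv uv; apply: ge0_le_integral => //.
- by move=> x _; rewrite lee_fin sqr_ge0.
- exact: sqint_measurable.
- exact: sqint_measurable.
- move=> x _; rewrite lee_fin -[leLHS]real_normK ?num_real//.
  by rewrite -[leRHS]real_normK ?num_real// ler_pXn2r ?nnegrE.
Qed.

Lemma sqintZ (a : R) u : measurable_fun setT u ->
  sqint (fun x => a * u x) = ((a ^+ 2)%:E * sqint u)%E.
Proof.
move=> mu; rewrite /sqint -ge0_integralZl//.
- by apply: eq_integral => x _; rewrite -EFinM exprMn.
- exact: sqint_measurable.
- by move=> x _; rewrite lee_fin sqr_ge0.
- by rewrite lee_fin sqr_ge0.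
Qed.

Lemma sqintD u v : measurable_fun setT u -> measurable_fun setT v ->
  (sqint (fun x => u x + v x)%R <= 2%:E * sqint u + 2%:E * sqint v)%E.
Proof.
move=> mu mv; rewrite /sqint -!ge0_integralZl//; try exact: sqint_measurable;
  try by move=> x _; rewrite lee_fin sqr_ge0.
rewrite -ge0_integralD//.
- apply: ge0_le_integral => //.
  + by move=> x _; rewrite lee_fin sqr_ge0.
  + exact/sqint_measurable/measurable_funD.
  + apply: emeasurable_funD; apply: measurable_funeM; exact: sqint_measurable.
  + move=> x _; rewrite -!EFinM -EFinD lee_fin.
    by have := sqr_ge0 (u x - v x); lra.
- by move=> x _; rewrite -EFinM lee_fin mulr_ge0// sqr_ge0.
- by apply: measurable_funeM; exact: sqint_measurable.
- by move=> x _; rewrite -EFinM lee_fin mulr_ge0// sqr_ge0.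
- by apply: measurable_funeM; exact: sqint_measurable.
Qed.

Lemma sqint_triangle (w u v : T -> R) : measurable_fun setT w ->
  measurable_fun setT u -> measurable_fun setT v ->
  (forall x, `|w x| <= `|u x| + `|v x|) ->
  (sqint w <= 2%:E * sqint u + 2%:E * sqint v)%E.
Proof.
move=> mw mu mv wuv.
have mnu : measurable_fun setT (fun x => `|u x|) by exact: measurableT_comp.
have mnv : measurable_fun setT (fun x => `|v x|) by exact: measurableT_comp.
have nE z : sqint (fun x => `|z x|) = sqint z.
  by apply: eq_integral => x _; rewrite real_normK ?num_real.
rewrite -(nE u) -(nE v); apply: le_trans (sqintD mnu mnv).
apply: sqint_le => //; first exact: measurable_funD.
by move=> x; rewrite (ger0_norm (addr_ge0 _ _)).
Qed.

(** The quarters of tolerances in the square-integral estimates below come from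
    [(a + b) ^ 2 <= 2 a ^ 2 + 2 b ^ 2]. *)
Lemma sqint_lt_triangle (w u v : T -> R) (e : R) : measurable_fun setT w ->
  measurable_fun setT u -> measurable_fun setT v ->
  (forall x, `|w x| <= `|u x| + `|v x|) ->
  (sqint u < (e / 4)%:E)%E -> (sqint v < (e / 4)%:E)%E -> (sqint w < e%:E)%E.
Proof.
move=> mw mu mv wuv ue ve; apply: le_lt_trans (sqint_triangle mw mu mv wuv) _.
have -> : e%:E = (2%:E * (e / 4)%:E + 2%:E * (e / 4)%:E)%E.
  by rewrite -!EFinM -EFinD; congr EFin; field.
by apply: lteD; rewrite lte_pmul2l.
Qed.

Lemma sqint_indic A : measurable A -> sqint \1_A = m A.
Proof.
move=> mA; rewrite -[RHS]mul1e -integral_cst// integral_mkcond.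
apply: eq_integral => x _; rewrite /patch indicE.
by case: (x \in A); rewrite ?expr1n ?expr0n.
Qed.

Lemma sqint_markov u (c : R) : 0 < c -> measurable_fun setT u ->
  ((c ^+ 2)%:E * m [set x | (c < `|u x|)%R] <= sqint u)%E.
Proof.
move=> c0 mu.
have mA : measurable [set x | c < `|u x|].
  have mlt : measurable_fun setT (fun x => c < `|u x|).
    by apply: measurable_fun_ltr => //; exact: measurableT_comp.
  rewrite [X in measurable X](_ : _ = setT `&` (fun x => c < `|u x|) @^-1` [set true]).
    exact: mlt.
  by rewrite setTI; apply/seteqP; split => x.
rewrite -sqint_indic// -sqintZ; last exact: measurable_indic.
apply: sqint_le => //; first exact: measurable_funM.
move=> x; rewrite indicE; have [|_] := boolP (x \in _).
  by rewrite inE/= => /ltW; rewrite mulr1 (gtr0_norm c0).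
by rewrite mulr0 normr0.
Qed.

Lemma sqint_cvg0 (u : nat -> T -> R) (g : T -> R) :
  (forall n, measurable_fun setT (u n)) -> (forall n x, `|u n x| <= g x) ->
  m.-integrable setT (fun x => (g x ^+ 2)%:E) ->
  (forall x, u n x @[n --> \oo] --> 0) -> sqint (u n) @[n --> \oo] --> 0%E.
Proof.
move=> mu ug ig u0.
have [] := @dominated_convergence _ T R m setT measurableT
  (fun n x => (u n x ^+ 2)%:E) (fun=> 0%E) (fun x => (g x ^+ 2)%:E).
- by move=> n; exact: sqint_measurable.
- exact: measurable_cst.
- apply: aeW => x _; apply/fine_cvgP; split; first exact: nearW.
  have := cvgM (u0 x) (u0 x); rewrite mulr0; exact.
- exact: ig.
- apply: aeW => x n _; rewrite abse_EFin lee_fin ger0_norm ?sqr_ge0//.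
  rewrite -[leLHS]real_normK ?num_real// ler_pXn2r ?nnegrE//.
  by rewrite (le_trans _ (ug n x)).
move=> _ _; by rewrite integral0.
Qed.

Lemma integrable_sqr_cst (c : R) : m.-integrable setT (fun=> (c ^+ 2)%:E).
Proof. exact: (finite_measure_integrable_cst m (c ^+ 2) measurableT). Qed.

End SquareIntegral.

(** * Closability *)

Section Clamp.
Variable R : realType.
Implicit Types (a b x y e : R).

Definition clamp a b x := Num.max a (Num.min b x).

Lemma clamp_hi a b x : a <= b -> b <= x -> clamp a b x = b.
Proof. by move=> ab bx; rewrite /clamp (min_idPl bx) (max_idPr ab). Qed.

Lemma clamp_lo a b x : a <= b -> x <= a -> clamp a b x = a.
Proof.
by move=> ab xa; rewrite /clamp (min_idPr (le_trans xa ab)) (max_idPl xa).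
Qed.

Lemma clamp_id a b x : a <= x <= b -> clamp a b x = x.
Proof. by move=> /andP[ax xb]; rewrite /clamp (min_idPr xb) (max_idPr ax). Qed.

Lemma clamp_itv a b x : a <= b -> a <= clamp a b x <= b.
Proof. by move=> ab; rewrite /clamp le_max lexx/= ge_max ab ge_min lexx. Qed.

Lemma clamp_mono_lip a b x y : x <= y -> 0 <= clamp a b y - clamp a b x <= y - x.
Proof.
rewrite /clamp => xy.
have [m0 m1] : 0 <= Num.min b y - Num.min b x /\ Num.min b y - Num.min b x <= y - x.
  by case: (leP b x) => ?; case: (leP b y) => ?; split; lra.
move: (Num.min b y) (Num.min b x) m0 m1 => u v ? ?.
by case: (leP a u) => ?; case: (leP a v) => ?; apply/andP; split; lra.
Qed.

Lemma clamp_lip a b x y : `|clamp a b x - clamp a b y| <= `|x - y|.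
Proof.
wlog xy : x y / x <= y.
  by move=> H; have [/H//|/ltW/H] := leP x y; rewrite distrC [leRHS]distrC.
have /andP[? ?] := clamp_mono_lip a b xy.
by rewrite distrC ger0_norm// distrC ger0_norm ?subr_ge0.
Qed.

Lemma clamp_contraction a b : a <= 0 <= b -> normal_contraction (clamp a b).
Proof. by move=> ab; split; [exact: clamp_id|exact: clamp_lip]. Qed.

(* The energy of [tail e f] is carried by [{|f| > e}], where [ramp e f = 1]. *)
Definition tail e x := x - clamp (- e) e x.
Definition ramp e x := clamp 0 1 (2 * `|x| / e - 1).

Lemma tail0 e x : `|x| <= e -> tail e x = 0.
Proof. by rewrite /tail ler_norml => xe; rewrite clamp_id// subrr. Qed.

Lemma tail_lip e x y : `|tail e x - tail e y| <= `|x - y|.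
Proof.
wlog xy : x y / x <= y.
  by move=> H; have [/H//|/ltW/H] := leP x y; rewrite distrC [leRHS]distrC.
have /andP[? ?] := clamp_mono_lip (- e) e xy.
by rewrite distrC [leRHS]distrC /tail !ger0_norm; lra.
Qed.

Lemma ramp_itv e x : 0 <= ramp e x <= 1.
Proof. exact: clamp_itv. Qed.

Lemma ramp1 e x : 0 < e -> e < `|x| -> ramp e x = 1.
Proof.
move=> e0 ex; rewrite /ramp clamp_hi// lerBrDr ler_pdivlMr//; lra.
Qed.

Lemma ramp_lip e x y : 0 < e -> `|ramp e x - ramp e y| <= 2 / e * `|x - y|.
Proof.
move=> e0; rewrite (le_trans (clamp_lip _ _ _ _))//.
rewrite (_ : _ - _ = 2 / e * (`|x| - `|y|)); last by field; lra.
rewrite normrM (gtr0_norm (divr_gt0 _ e0))// ler_pM2l ?divr_gt0//.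
exact: ler_dist_dist.
Qed.

(** Convergence in mean square of [f n] to zero passes through this bound to [ramp e (f n)] for
    fixed [e]. *)
Lemma ramp_le e x : 0 < e -> `|ramp e x| <= `|2 / e * x|.
Proof.
move=> e0; have e2 : 0 < 2 / e by rewrite divr_gt0.
have r0 : ramp e 0 = 0 by rewrite /ramp clamp_lo// normr0 mulr0 mul0r; lra.
by have := ramp_lip x 0 e0; rewrite r0 !subr0 normrM (gtr0_norm e2).
Qed.

(** Both tails vanish unless one of the points exceeds [e] in absolute value, and then its ramp is 1
    while [tail] is 1-Lipschitz. *)
Lemma tail_ramp e x y : 0 < e ->
  (tail e x - tail e y) ^+ 2 <= (x - y) ^+ 2 * (ramp e x + ramp e y).
Proof.
move=> e0; have /andP[x0 x1] := ramp_itv e x; have /andP[y0 y1] := ramp_itv e y.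
have txy : (tail e x - tail e y) ^+ 2 <= (x - y) ^+ 2.
  rewrite -[leLHS]real_normK ?num_real// -[leRHS]real_normK ?num_real//.
  by rewrite ler_pXn2r ?nnegrE ?tail_lip.
have [xe|xe] := leP `|x| e; have [ye|ye] := leP `|y| e.
- by rewrite !tail0// subrr expr0n/= mulr_ge0 ?sqr_ge0// addr_ge0.
- by rewrite (le_trans txy)// ler_peMr ?sqr_ge0// (ramp1 e0 ye); lra.
- by rewrite (le_trans txy)// ler_peMr ?sqr_ge0// (ramp1 e0 xe); lra.
- by rewrite (le_trans txy)// ler_peMr ?sqr_ge0// (ramp1 e0 xe); lra.
Qed.

Lemma tail_ramp_sqr e x : 0 < e -> tail e x ^+ 2 <= x ^+ 2 * ramp e x.
Proof.
move=> e0; have [xe|xe] := leP `|x| e.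
  by rewrite tail0// expr0n mulr_ge0 ?sqr_ge0//; case/andP: (ramp_itv e x).
rewrite (ramp1 e0 xe) mulr1.
rewrite -[leLHS]real_normK ?num_real// -[leRHS]real_normK ?num_real//.
rewrite ler_pXn2r ?nnegrE//; have := tail_lip e x 0.
by rewrite (_ : tail e 0 = 0) ?subr0// tail0// normr0 ltW.
Qed.

End Clamp.

(** * From energy dominance to closability *)

Section EnergyDominance.
Variables (R : realType) (X : pointedType).
Variables (D : set (X -> R)) (E : (X -> R) -> (X -> R) -> R).
Variable m : {finite_measure set (g_sigma_algebraType (sigmaGen D)) -> \bar R}.
Hypotheses (algD : bounded_algebra D) (formE : bilinear_form E D)
           (closE : supnorm_closable E D) (contrE : contractions_operate E D)
           (domE : energy_dominant E m).
Local Notation T := (g_sigma_algebraType (sigmaGen D)).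
Local Notation L := (Defs.Lfun E).
Implicit Types (f g h k : X -> R).

Lemma dom_measurable f : D f -> measurable_fun (setT : set T) (f : T -> R).
Proof.
move=> Df _ B mB; rewrite setTI; apply: sub_sigma_algebra.
by exists f, B.
Qed.

Lemma dom_clamp (a b : R) f : a <= 0 <= b -> D f -> D (fun x => clamp a b (f x)).
Proof. by move=> ab Df; have [] := contrE (clamp_contraction ab) Df. Qed.

Lemma dom_abs f : D f -> D (fun x => `|f x|).
Proof.
have nc : normal_contraction (fun x : R => `|x|).
  by split; [exact: normr0|exact: ler_dist_dist].
by move=> Df; have [] := contrE nc Df.
Qed.

Lemma dom_max f g : D f -> D g -> D (fun x => Num.max (f x) (g x)).
Proof.
move=> Df Dg.
have := dom_scale algD 2^-1 (dom_add algD (dom_add algD Df Dg) (dom_abs (dom_sub algD Df Dg))).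
rewrite (_ : _ *: _ = fun x => Num.max (f x) (g x))//.
by apply/funext => x; rewrite maxr_absE fctZE mulrC.
Qed.

Lemma dom_min f g : D f -> D g -> D (fun x => Num.min (f x) (g x)).
Proof.
move=> Df Dg.
have := dom_scale algD 2^-1 (dom_sub algD (dom_add algD Df Dg) (dom_abs (dom_sub algD Df Dg))).
rewrite (_ : _ *: _ = fun x => Num.min (f x) (g x))//.
by apply/funext => x; rewrite minr_absE fctZE mulrC.
Qed.

Lemma LD f h k : D f -> D h -> D k -> L f (h + k) = L f h + L f k.
Proof.
move=> Df Dh Dk; rewrite /Defs.Lfun (EDr algD formE)//; last exact: (dom_sqr algD).
rewrite (_ : (fun x => f x * (h + k) x) = (fun x => f x * h x) + (fun x => f x * k x)).
  by rewrite (EDl formE)//; [ring|exact: (dom_mul algD)..].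
by apply/funext => x; rewrite !fctE mulrDr.
Qed.

Lemma LZ (a : R) f h : D f -> D h -> L f (a *: h) = a * L f h.
Proof.
move=> Df Dh; rewrite /Defs.Lfun (EZr algD formE)//; last exact: (dom_sqr algD).
rewrite (_ : (fun x => f x * (a *: h) x) = a *: (fun x => f x * h x)).
  by rewrite (EZl algD formE)//; [ring|exact: (dom_mul algD)].
by apply/funext => x; rewrite !fctZE mulrCA.
Qed.

Lemma LB f h k : D f -> D h -> D k -> L f (h - k) = L f h - L f k.
Proof.
move=> Df Dh Dk; rewrite -[- k]scaleN1r LD//; last exact: (dom_scale algD).
by rewrite LZ// mulN1r.
Qed.

Lemma L_le_mono f h k : D f -> D h -> D k -> (forall x, h x <= k x) -> L f h <= L f k.
Proof.
move=> Df Dh Dk hk; rewrite -subr_ge0 -LB//.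
apply: (L_ge0 algD formE closE contrE) => //; first exact: (dom_sub algD).
by move=> x; rewrite subr_ge0.
Qed.

(** For fixed [h] the functional is quadratic in [f]; the discarded parallelogram term, at [f - g],
    is nonnegative. *)
Lemma L_quad_le f g h : D f -> D g -> D h -> (forall x, 0 <= h x) ->
  L (f + g) h <= 2 * L f h + 2 * L g h.
Proof.
move=> Df Dg Dh h0.
have := L_ge0 algD formE closE contrE (dom_sub algD Df Dg) Dh h0.
suff : L (f + g) h + L (f - g) h = 2 * L f h + 2 * L g h by lra.
have DM' := dom_mul algD; have DD' := dom_add algD.
have DB' := dom_sub algD; have DZ' := dom_scale algD.
have DS' := dom_sqr algD.
rewrite /Defs.Lfun.
have -> : (fun x => (f + g) x * h x) = (fun x => f x * h x) + (fun x => g x * h x).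
  by apply/funext => x; rewrite !fctE; ring.
have -> : (fun x => (f - g) x * h x) = (fun x => f x * h x) - (fun x => g x * h x).
  by apply/funext => x; rewrite !fctE; ring.
have -> : (fun x => (f + g) x ^+ 2) =
    ((fun x => f x ^+ 2) + (fun x => g x ^+ 2)) + 2 *: (fun x => f x * g x).
  by apply/funext => x; rewrite !fctE /GRing.scale/=; ring.
have -> : (fun x => (f - g) x ^+ 2) =
    ((fun x => f x ^+ 2) + (fun x => g x ^+ 2)) - 2 *: (fun x => f x * g x).
  by apply/funext => x; rewrite !fctE /GRing.scale/=; ring.
have Dfh := DM' _ _ Df Dh; have Dgh := DM' _ _ Dg Dh; have Dfg := DM' _ _ Df Dg.
have Df2 := DS' _ Df; have Dg2 := DS' _ Dg.
have DN' := dom_opp algD.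
have D1 := DD' _ _ Df2 Dg2; have D2 := DZ' 2 _ Dfg; have D3 := DN' _ D2.
have D4 := DN' _ Dgh; have D5 := DN' _ Dg; have D6 := DD' _ _ Df Dg; have D7 := DB' _ _ Df Dg.
rewrite (EDl formE Dfh Dgh D6) (EDl formE Dfh D4 D7) (EDl formE D1 D2 Dh) (EDl formE D1 D3 Dh).
rewrite (ENl algD formE D2 Dh) (EDl formE Df2 Dg2 Dh) (ENl algD formE Dgh D7).
rewrite !(EDr algD formE)// !(ENr algD formE)//; lra.
Qed.

(** Such an [h] competes in the supremum defining the energy measure of [{h > 0}]. *)
Lemma energy_dominant_L f (eps : R) : D f -> 0 < eps -> exists2 delta : R, 0 < delta &
  forall h, D h -> (forall x, 0 <= h x <= 1) -> (m [set x | (0 < h x)%R] < delta%:E)%E ->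
    L f h < eps.
Proof.
move=> Df eps0; have [delta delta0 dP] := domE Df eps0; exists delta => //.
move=> h Dh h01 mh; rewrite -lte_fin; apply: le_lt_trans (dP _ _ mh).
  have Sh : Sets D [set x | 0 < h x] by exists h.
  rewrite /Gamma asboolT//; apply: ereal_sup_ubound; exists h => //; split => // x.
  have /andP[h0 h1] := h01 x; rewrite h0/= indicE.
  have [_|] := boolP (x \in _); first by [].
  by rewrite notin_setE/= => /negP; rewrite -leNgt.
by apply: sub_gen_smallest; exists h.
Qed.

(** Smallness in mean square does not make the support of [h] small. The part of [h] below the level
    [eta] is controlled by [L_le] after rescaling; the rest lives on [{h > eta}], which is small by
    Chebyshev's inequality. *)
Lemma energy_dominant_L2 f (eps : R) : D f -> 0 < eps -> exists2 delta : R, 0 < delta &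
  forall h, D h -> (forall x, 0 <= h x <= 1) -> (sqint m h < delta%:E)%E ->
    L f h < eps.
Proof.
move=> Df eps0; have [d d0 dP] := energy_dominant_L Df (divr_gt0 eps0 (ltr0n _ 2 : 0 < 2)).
have Ef0 := E_ge0 formE Df.
pose eta := Num.min 1 (eps / (4 * (E f f + 1))).
have eta0 : 0 < eta by rewrite lt_min ltr01/= divr_gt0// mulr_gt0// ltr_wpDl.
have eta1 : eta <= 1 by rewrite ge_min lexx.
exists (eta ^+ 2 * d); first by rewrite mulr_gt0// exprn_gt0.
move=> h Dh h01 hd.
have eta0' : (0 : R) <= 0 <= eta by apply/andP; split => //; exact: ltW.
pose k := fun x => clamp 0 eta (h x).
have Dk : D k by exact: dom_clamp.
have DB' := dom_sub algD.
have Dhk : D (h - k) by exact: DB'.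
have -> : h = k + (h - k) by rewrite addrC subrK.
have Lk : L f k <= eta * (2 * E f f).
  have ke x : `|k x| <= eta by rewrite ger0_norm; case/andP: (clamp_itv (h x) (ltW eta0)).
  have -> : k = eta *: (eta^-1 *: k) by rewrite scalerA mulfV ?scale1r// gt_eqF.
  rewrite LZ//; last exact: (dom_scale algD).
  rewrite ler_pM2l//; apply: (L_le algD formE closE contrE) => //; first exact: (dom_scale algD).
  move=> x; rewrite fctZE mulrC ler_pdivrMr// mul1r.
  by rewrite (le_trans (ler_norm _)).
have hk x : 0 <= (h - k) x <= 1 /\ (0 < (h - k) x -> eta < `|h x|).
  have /andP[h0 h1] := h01 x; rewrite !fctE /k (ger0_norm h0); have [he|he] := leP (h x) eta.
    by rewrite clamp_id ?h0// subrr lexx ler01 ltxx; split.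
  by rewrite clamp_hi ?(ltW eta0) ?(ltW he)//; split => [|//]; apply/andP; split; lra.
have Lhk : L f (h - k) < eps / 2.
  apply: dP => //; first by move=> x; exact: (hk x).1.
  have mh := dom_measurable Dh.
  have := le_lt_trans (sqint_markov m eta0 mh) hd.
  rewrite (EFinM (eta ^+ 2) d) lte_pmul2l ?lte_fin ?exprn_gt0//; apply: le_lt_trans.
  apply: le_measure; rewrite ?inE.
  - have := dom_measurable Dhk measurableT (measurable_itv `]0, +oo[).
    rewrite setTI; congr measurable; apply/seteqP.
    by split => x /=; rewrite in_itv/= andbT.
  - have mn : measurable_fun (setT : set T) (fun x : T => `|h x|) by exact: measurableT_comp.
    have := mn measurableT _ (measurable_itv `]eta, +oo[).
    rewrite setTI; congr measurable; apply/seteqP.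
    by split => x /=; rewrite in_itv/= andbT.
  - by move=> x; exact: (hk x).2.
rewrite LD//.
have : eta * (2 * E f f) <= eps / 2.
  apply: (@le_trans _ _ (eps / (4 * (E f f + 1)) * (2 * E f f))).
    by rewrite ler_wpM2r ?mulr_ge0// ge_min lexx orbT.
  rewrite mulrAC ler_pdivrMr ?mulr_gt0 ?ltr_wpDl//; nra.
lra.
Qed.

Lemma L2_closable_of_dominance : L2_closable E m.
Proof.
move=> f Df cf f0.
have mf n := dom_measurable (Df n).
have DB' := dom_sub algD.
have small (e eps : R) : 0 < e -> 0 < eps -> exists N, forall n, (N <= n)%N ->
    E (fun x => tail e (f n x)) (fun x => tail e (f n x)) < eps.
  move=> e0 eps0.
  (* Dominance is not uniform in the function, so [N] is fixed before [d], and [f n] is compared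
     with the single function [f N]: four times [eps / 8] plus twice [eps / 4] is [eps]. *)
  have [N NP] := cf (eps / 8) (divr_gt0 eps0 (ltr0n _ 8 : 0 < 8)).
  have [d d0 dP] := energy_dominant_L2 (Df N) (divr_gt0 eps0 (ltr0n _ 4 : 0 < 4)).
  have d0' : 0 < d / (2 / e) ^+ 2 by rewrite divr_gt0// exprn_gt0// divr_gt0.
  have [N' N'P] : exists N, forall n, (N <= n)%N ->
      (sqint m (f n) < (d / (2 / e) ^+ 2)%:E)%E.
    have fE n : sqint m (fun x => f n x - 0) = sqint m (f n).
      by apply: eq_integral => x _; rewrite subr0.
    have [N' N'P] := (cvge0P (fun n => sqint_ge0 m (fun x => f n x - 0))).1 f0 _ d0'.
    by exists N' => n /N'P; rewrite fE.
  exists (maxn N N') => n; rewrite geq_max => /andP[Nn N'n].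
  pose h := fun x => ramp e (f n x).
  have h01 x : 0 <= h x <= 1 by exact: ramp_itv.
  have h0 x : 0 <= h x by case/andP: (h01 x).
  have Dh : D h.
    apply: (@dom_lipschitz _ _ _ _ algD contrE (ramp e) (2 / e)) => //.
    - exact: divr_gt0.
    - by rewrite /ramp clamp_lo// normr0 mulr0 mul0r; lra.
    - by move=> x y; exact: ramp_lip.
  have Dt : D (fun x => tail e (f n x)).
    by apply: (DB' (f n)) => //; apply: dom_clamp => //; apply/andP; split; lra.
  have DfN : D (f n - f N) by exact: DB'.
  have Etail : E (fun x => tail e (f n x)) (fun x => tail e (f n x)) <= L (f n) h.
    apply: (E_le_L algD formE closE contrE) => //.
      by move=> x y; exact: tail_ramp.
    by move=> x; exact: tail_ramp_sqr.
  rewrite (le_lt_trans Etail)//.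
  have -> : f n = (f n - f N) + f N by rewrite subrK.
  apply: (le_lt_trans (L_quad_le DfN (Df N) Dh h0)).
  have : L (f n - f N) h <= 2 * E (f n - f N) (f n - f N).
    by apply: (L_le algD formE closE contrE) => // x; case/andP: (h01 x).
  have := NP _ _ Nn (leqnn N); rewrite -[(fun x => f n x - f N x)]/(f n - f N).
  have : L (f N) h < eps / 4.
    apply: dP => //; have := N'P n N'n.
    have a0 : 0 < (2 / e) ^+ 2 by rewrite exprn_gt0// divr_gt0.
    move=> fd; have : (((2 / e) ^+ 2)%:E * sqint m (f n) < d%:E)%E.
      by rewrite -[d](divfK (lt0r_neq0 a0)) [d / _ * _]mulrC (EFinM ((2 / e) ^+ 2)) lte_pmul2l.
    apply: le_lt_trans; rewrite -sqintZ//; apply: sqint_le => //.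
    - exact: dom_measurable.
    - by apply: measurable_funM.
    - by move=> x; exact: ramp_le.
  lra.
(* A diagonal choice: the truncation level tends to zero along a subsequence while the energy of the
   tails does too. The truncations [g] are then E-Cauchy and uniformly small. *)
have kP (k : nat) : exists n, (k <= n)%N /\ E (fun x => tail k.+1%:R^-1 (f n x))
    (fun x => tail k.+1%:R^-1 (f n x)) < k.+1%:R^-1.
  have [||N NP] := small k.+1%:R^-1 k.+1%:R^-1; rewrite ?invr_gt0//.
  by exists (maxn k N); split; [exact: leq_maxl|apply: NP; exact: leq_maxr].
have [nk nkP] := choice kP.
pose t (k : nat) := fun x => tail k.+1%:R^-1 (f (nk k) x).
pose g (k : nat) := fun x => clamp (- k.+1%:R^-1) k.+1%:R^-1 (f (nk k) x).
have ck (k : nat) : - k.+1%:R^-1 <= (0 : R) <= k.+1%:R^-1.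
  by rewrite oppr_le0 invr_ge0 ler0n.
have Dg (k : nat) : D (g k) by exact: dom_clamp.
have Dt (k : nat) : D (t k) by exact: (DB' _ _ (Df (nk k)) (Dg k)).
have fgt (k : nat) : f (nk k) = g k + t k.
  by apply/funext => x; rewrite !fctE /t /tail /g addrC subrK.
have inv_small (e : R) : 0 < e -> exists N, forall n, (N <= n)%N -> (n.+1%:R^-1 : R) < e.
  by move=> e0; have [N _ NP] := near_infty_natSinv_lt (PosNum e0); exists N => n /NP.
have E_le2' := E_le2 algD formE.
have DN' := dom_opp algD.
have gcauchy : E_cauchy E g.
  move=> e e0.
  have [N1 N1P] := cf (e / 8) (divr_gt0 e0 (ltr0n _ 8 : 0 < 8)).
  have [N2 N2P] := inv_small (e / 16) (divr_gt0 e0 (ltr0n _ 16 : 0 < 16)).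
  exists (maxn N1 N2) => a b; rewrite !geq_max => /andP[a1 a2] /andP[b1 b2].
  rewrite (_ : (fun x => _) = (f (nk a) - f (nk b)) + (t b - t a)); last first.
    by apply/funext => x; rewrite !fgt !fctE; ring.
  have := E_le2' _ _ (DB' _ _ (Df (nk a)) (Df (nk b))) (DB' _ _ (Dt b) (Dt a)).
  have := N1P _ _ (leq_trans a1 (nkP a).1) (leq_trans b1 (nkP b).1).
  rewrite -[(fun x => f (nk a) x - _)]/(f (nk a) - f (nk b)).
  have := E_le2' _ _ (Dt b) (DN' _ (Dt a)); rewrite (ENl algD formE) ?(ENr algD formE)//;
    last exact: DN'.
  have := lt_trans (nkP a).2 (N2P _ a2); have := lt_trans (nkP b).2 (N2P _ b2).
  rewrite -/(t a) -/(t b); lra.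
have gsup : supnorm (g n) @[n --> \oo] --> 0.
  apply: (@squeeze_cvgr _ _ _ _ (cst 0) (fun n => n.+1%:R^-1)).
  - near=> n; apply: supnorm_le => // x.
    rewrite ler_norml; apply: clamp_itv; case/andP: (ck n); exact: le_trans.
  - exact: cvg_cst.
  - exact: cvg_harmonic.
have g0 := closE Dg gcauchy gsup.
apply/cvgr0Pnorm_lt => e e0.
(* The energy of [f n] is at most twice that of [f n - f (nk K)] plus four times those of [g K] and
   [t K]: [e / 2 + e / 4 + e / 4]. *)
have [N1 N1P] := cf (e / 4) (divr_gt0 e0 (ltr0n _ 4 : 0 < 4)).
have e16 : 0 < e / 16 by rewrite divr_gt0.
have [N2 N2P] := inv_small _ e16.
have [N3 _ N3P] := (cvgr0Pnorm_lt _).1 g0 _ e16.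
exists N1 => // n /= N1n.
pose K := maxn N1 (maxn N2 N3).
have [K1 K2 K3] : [/\ (N1 <= K)%N, (N2 <= K)%N & (N3 <= K)%N].
  by rewrite /K !leq_max !leqnn !orbT.
have Kn : (N1 <= nk K)%N by exact: leq_trans (nkP K).1.
rewrite ger0_norm ?(E_ge0 formE)//.
have -> : f n = (f n - f (nk K)) + f (nk K) by rewrite subrK.
apply: (le_lt_trans (E_le2' _ _ (DB' _ _ (Df n) (Df _)) (Df _))).
have := N1P _ _ N1n Kn; rewrite -[(fun x => f n x - _)]/(f n - f (nk K)).
have := N3P K K3; rewrite /= ger0_norm ?(E_ge0 formE)//.
have := lt_trans (nkP K).2 (N2P _ K2); rewrite -/(t K).
have := E_le2' _ _ (Dg K) (Dt K); rewrite -fgt.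
lra.
Unshelve. all: by end_near.
Qed.

End EnergyDominance.

(** * Density *)

Section Density.
Import HBNNSimple.
Variables (R : realType) (X : pointedType).
Variables (D : set (X -> R)) (E : (X -> R) -> (X -> R) -> R) (chi : X -> R).
Variable m : {finite_measure set (g_sigma_algebraType (sigmaGen D)) -> \bar R}.
Hypotheses (algD : bounded_algebra D) (formE : bilinear_form E D)
           (contrE : contractions_operate E D)
           (Dchi : D chi) (chi_gt0 : forall x, 0 < chi x).
Local Notation T := (g_sigma_algebraType (sigmaGen D)).
Implicit Types (f g h k : X -> R) (A B : set T).

Lemma sqintBC (u v : T -> R) :
  sqint m (fun x => u x - v x) = sqint m (fun x => v x - u x).
Proof. by apply: eq_integral => x _; congr EFin; ring. Qed.

Lemma sqintB_triangle (u v w : T -> R) (e : R) : measurable_fun setT u ->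
  measurable_fun setT v -> measurable_fun setT w ->
  (sqint m (fun x => u x - v x)%R < (e / 4)%:E)%E ->
  (sqint m (fun x => v x - w x)%R < (e / 4)%:E)%E ->
  (sqint m (fun x => u x - w x)%R < e%:E)%E.
Proof.
move=> mu mv mw; apply: sqint_lt_triangle; try exact: measurable_funB.
move=> x; apply: le_trans (ler_normD _ _).
by rewrite addrA subrK.
Qed.

(** The approximants take values in [[0, 1]] because the estimates on [Lfun] require it. *)
Definition approximable A := measurable A /\ forall e : R, 0 < e -> exists h,
  [/\ D h, forall x, 0 <= h x <= 1 & (sqint m (fun x => h x - \1_A x)%R < e%:E)%E].

(** A replacement for the constant 1, which need not belong to [D]; at each point it is eventually
    equal to 1 since [chi] is positive there. *)
Definition unit_approx (n : nat) : X -> R := fun x => clamp 0 1 (n%:R * chi x).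

Lemma unit_approxD n : D (unit_approx n).
Proof.
apply: (dom_clamp contrE (f := n%:R *: chi)); first by rewrite lexx ler01.
exact: (dom_scale algD).
Qed.

Lemma eventually_ge1 (c : R) : 0 < c -> exists N, forall n, (N <= n)%N -> 1 <= n%:R * c.
Proof.
move=> c0; exists (Num.truncn c^-1).+1 => n Nn.
rewrite -ler_pdivrMr// mul1r (le_trans (ltW (truncnS_gt _)))//.
by rewrite ler_nat.
Qed.

Lemma unit_approx1 x : exists N, forall n, (N <= n)%N -> unit_approx n x = 1.
Proof.
have [N NP] := eventually_ge1 (chi_gt0 x); exists N => n /NP ?.
by rewrite /unit_approx clamp_hi.
Qed.

Lemma eventually_cst_cvg (u : nat -> R) (a : R) :
  (exists N, forall n, (N <= n)%N -> u n = a) -> u n @[n --> \oo] --> a.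
Proof.
move=> [N NP]; apply: (@cvg_near_cst _ _ _ _ _ _ _).
by exists N => // n /= /NP.
Qed.

Lemma sqint_eventually (h : nat -> T -> R) (u : T -> R) :
  (forall n, measurable_fun setT (h n)) -> measurable_fun setT u ->
  (forall n x, 0 <= h n x <= 1) -> (forall x, 0 <= u x <= 1) ->
  (forall x, exists N, forall n, (N <= n)%N -> h n x = u x) ->
  forall e : R, 0 < e -> exists N, forall n, (N <= n)%N ->
    (sqint m (fun x => h n x - u x)%R < e%:E)%E.
Proof.
move=> mh mu h01 u01 hu; apply/(cvge0P (fun n => sqint_ge0 m _)).
apply: (@sqint_cvg0 _ _ _ _ _ (fun=> 1)).
- by move=> n; exact: measurable_funB.
- move=> n x; have /andP[? ?] := h01 n x; have /andP[? ?] := u01 x.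
  by rewrite ler_norml; apply/andP; split; lra.
- exact: integrable_sqr_cst.
- move=> x; apply: eventually_cst_cvg; have [N NP] := hu x.
  by exists N => n /NP ->; rewrite subrr.
Qed.

Lemma indic01 A x : 0 <= (\1_A x : R) <= 1.
Proof. by rewrite indicE; case: (x \in A); rewrite ?lexx ?ler01. Qed.

Lemma approximable_eventually (h : nat -> X -> R) A : measurable A ->
  (forall n, D (h n)) -> (forall n x, 0 <= h n x <= 1) ->
  (forall x, exists N, forall n, (N <= n)%N -> h n x = \1_A x) -> approximable A.
Proof.
move=> mA Dh h01 hA; split => // e e0.
have [|||N NP] := @sqint_eventually h (\1_A) _ _ h01 _ hA _ e0.
- by move=> n; exact: dom_measurable.
- exact: measurable_indic.
- exact: indic01.
- by exists (h N); split => //; exact: NP.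
Qed.

Lemma approximable_setC A : approximable A -> approximable (~` A).
Proof.
move=> [mA appA]; split; first exact: measurableC.
move=> e e0; have e4 : 0 < e / 4 by rewrite divr_gt0.
have [||||N NP] := @sqint_eventually unit_approx (fun=> 1) _ _ _ _ unit_approx1 _ e4.
- by move=> n; exact: (dom_measurable (unit_approxD n)).
- exact: measurable_cst.
- by move=> n x; exact: clamp_itv.
- by move=> x; rewrite ler01 lexx.
have [h [Dh h01 hA]] := appA _ e4.
pose u := unit_approx N; have Du : D u := unit_approxD N.
have u01 x : 0 <= u x <= 1 by exact: clamp_itv.
(* The function [1 - h] may fall outside [D], so 1 is replaced by [u]; the positive part restores
   the range. *)
pose k := fun x => Num.max (u x - h x) 0.
have Dk : D k by apply: (dom_max algD contrE); [exact: (dom_sub algD)|exact: (dom0 algD)].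
exists k; split => //.
  move=> x; rewrite /k le_max lexx orbT/= ge_max ler01 andbT.
  by have /andP[? ?] := h01 x; have /andP[? ?] := u01 x; lra.
have mC := measurableC mA.
apply: (@sqint_lt_triangle _ _ _ m _ (fun x => u x - 1) (fun x => h x - \1_A x)).
- by apply: measurable_funB; [exact: dom_measurable|exact: measurable_indic].
- by apply: measurable_funB; [exact: dom_measurable|exact: measurable_cst].
- by apply: measurable_funB; [exact: dom_measurable|exact: measurable_indic].
- move=> x; rewrite /k !indicE in_setC; have /andP[? ?] := h01 x; have /andP[? ?] := u01 x.
  have := ler_norm (u x - 1); have := ler_norm (- (u x - 1)).
  have := ler_norm (h x - (x \in A)%:R); have := ler_norm (- (h x - (x \in A)%:R)).
  rewrite !normrN; move: (x \in A) => [] /=; rewrite ?mulr1n ?mulr0n;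
    case: (leP (u x - h x) 0) => ? ? ? ? ?;
    by rewrite ler_norml; apply/andP; split; lra.
- exact: NP.
- exact: hA.
Qed.

Lemma approximable_setU A B : approximable A -> approximable B -> approximable (A `|` B).
Proof.
move=> [mA appA] [mB appB]; split; first exact: measurableU.
move=> e e0; have e4 : 0 < e / 4 by rewrite divr_gt0.
have [h [Dh h01 hA]] := appA _ e4; have [k [Dk k01 kB]] := appB _ e4.
have Dhk := dom_max algD contrE Dh Dk.
exists (fun x => Num.max (h x) (k x)); split => //.
  move=> x; have /andP[? ?] := h01 x; have /andP[? ?] := k01 x.
  by rewrite le_max ge_max; apply/andP; split; [apply/orP; left|apply/andP].
apply: (@sqint_lt_triangle _ _ _ m _ (fun x => h x - \1_A x) (fun x => k x - \1_B x)).
- apply: measurable_funB; first exact: dom_measurable.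
  by apply: measurable_indic; exact: measurableU.
- by apply: measurable_funB; [exact: dom_measurable|exact: measurable_indic].
- by apply: measurable_funB; [exact: dom_measurable|exact: measurable_indic].
- move=> x; rewrite !indicE in_setU; have /andP[? ?] := h01 x; have /andP[? ?] := k01 x.
  have := ler_norm (h x - (x \in A)%:R); have := ler_norm (- (h x - (x \in A)%:R)).
  have := ler_norm (k x - (x \in B)%:R); have := ler_norm (- (k x - (x \in B)%:R)).
  rewrite !normrN; move: (x \in A) (x \in B) => [] [] /=; rewrite ?mulr1n ?mulr0n;
    case: (leP (h x) (k x)) => ? ? ? ? ?;
    by rewrite ler_norml; apply/andP; split; lra.
- exact: hA.
- exact: kB.
Qed.

Lemma approximable_set0 : approximable set0.
Proof.
split => // e e0; exists 0; split; [exact: (dom0 algD)|by move=> x; rewrite lexx ler01|].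
rewrite (_ : (fun x => _) = fun=> 0); last by apply/funext => x; rewrite indic0 subr0.
rewrite /sqint; under eq_integral do rewrite expr0n.
by rewrite integral0 lte_fin.
Qed.

Lemma approximable_bigcup (F : nat -> set T) : (forall n, approximable (F n)) ->
  approximable (\bigcup_n F n).
Proof.
move=> appF.
pose G n := \big[setU/set0]_(i < n) F i.
have appG n : approximable (G n).
  rewrite /G; elim: n => [|n IH]; first by rewrite big_ord0; exact: approximable_set0.
  by rewrite big_ord_recr; exact: approximable_setU.
have mF : measurable (\bigcup_n F n) by apply: bigcupT_measurable => n; case: (appF n).
split => // e e0; have e4 : 0 < e / 4 by rewrite divr_gt0.
have mG n : measurable_fun (setT : set T) (\1_(G n) : T -> R).
  by apply: measurable_indic; case: (appG n).
have mI : measurable_fun (setT : set T) (\1_(\bigcup_n F n) : T -> R).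
  exact: measurable_indic.
have [|||N NP] := @sqint_eventually (fun n => \1_(G n)) _ mG mI _ _ _ _ e4.
- by move=> n x; exact: indic01.
- by move=> x; exact: indic01.
- move=> x; have [[i _ Fix]|nF] := pselect ((\bigcup_n F n) x).
    exists i.+1 => n ni; rewrite !indicE !mem_set//; first by exists i.
    by rewrite /G -bigcup_mkord; exists i.
  exists 0%N => n _; rewrite !indicE !memNset//.
  by rewrite /G -bigcup_mkord => -[i _ Fi]; apply: nF; exists i.
have [h [Dh h01 hG]] := (appG N).2 _ e4.
exists h; split => //.
apply: (@sqintB_triangle _ (\1_(G N))) => //; first exact: dom_measurable.
exact: NP.
Qed.

Lemma approximable_superlevel f (c : R) : D f ->
  approximable (f @^-1` `]c, +oo[%classic).
Proof.
(* The constant [c] is replaced by [c * unit_approx n x], which keeps [h n] in [D] even for negative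
   [c]. *)
move=> Df; pose h (n : nat) := fun x => clamp 0 1 (n%:R * (f x - c * unit_approx n x)).
have Dcu n : D (f - c *: unit_approx n).
  by apply: (dom_sub algD Df); apply: (dom_scale algD); exact: unit_approxD.
apply: (@approximable_eventually h).
- by rewrite -[X in measurable X]setTI; exact: (dom_measurable Df).
- move=> n; apply: (dom_clamp contrE (f := n%:R *: (f - c *: unit_approx n))).
    by rewrite lexx ler01.
  exact: (dom_scale algD).
- by move=> n x; exact: clamp_itv.
- move=> x; have [N NP] := unit_approx1 x.
  rewrite indicE; have [|] := boolP (x \in _).
    rewrite inE/= in_itv/= andbT => cf.
    have fc0 : 0 < f x - c by rewrite subr_gt0.
    have [N' N'P] := eventually_ge1 fc0; exists (maxn N N') => n.
    by rewrite geq_max => /andP[/NP un /N'P fn]; rewrite /h un mulr1 clamp_hi.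
  rewrite notin_setE/= in_itv/= andbT => /negP; rewrite -leNgt => fc.
  exists N => n /NP un; rewrite /h un mulr1 clamp_lo//.
  by rewrite mulr_ge0_le0// subr_le0.
Qed.

(** Approximable sets form a sigma-algebra; since open rays generate the Borel sets of the line, it
    suffices that superlevel sets of functions in [D] belong to it. *)
Lemma measurable_approximable A : measurable A -> approximable A.
Proof.
have app_sigma : sigma_algebra setT approximable.
  split.
  - exact: approximable_set0.
  - by move=> B; rewrite setTD; exact: approximable_setC.
  - exact: approximable_bigcup.
move: A; apply: smallest_sub => // _ [f [B [Df mB ->]]].
suff : [set B : set R | approximable (f @^-1` B)] B by [].
have : (@RGenOInfty.G R).-sigma.-measurable B by rewrite -RGenOInfty.measurableE.
move: B {mB}; apply: smallest_sub.
  case: app_sigma => s0 sC sU; split => /=.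
  - by rewrite preimage_set0.
  - by move=> B /sC.
  - by move=> F FP; rewrite preimage_bigcup; exact: sU.
by move=> _ [c ->]; exact: approximable_superlevel.
Qed.

Definition L2_approximable (u : T -> R) := measurable_fun setT u /\
  forall e : R, 0 < e -> exists2 f, D f & (sqint m (fun x => f x - u x)%R < e%:E)%E.

Lemma L2_approximable_indic A : measurable A -> L2_approximable \1_A.
Proof.
move=> mA; split; first exact: measurable_indic.
by move=> e e0; have [h [Dh _ hA]] := (measurable_approximable mA).2 _ e0; exists h.
Qed.

Lemma L2_approximableD (u v : T -> R) : L2_approximable u -> L2_approximable v ->
  L2_approximable (fun x => u x + v x).
Proof.
move=> [mu au] [mv av]; split; first exact: measurable_funD.
move=> e e0; have e4 : 0 < e / 4 by rewrite divr_gt0.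
have [f Df fu] := au _ e4; have [g Dg gv] := av _ e4.
exists (f + g); first exact: (dom_add algD).
apply: (@sqint_lt_triangle _ _ _ m _ (fun x => f x - u x) (fun x => g x - v x)) => //.
- apply: measurable_funB; last exact: measurable_funD.
  exact: (dom_measurable (dom_add algD Df Dg)).
- by apply: measurable_funB => //; exact: dom_measurable.
- by apply: measurable_funB => //; exact: dom_measurable.
- by move=> x; rewrite !fctE opprD addrACA ler_normD.
Qed.

Lemma L2_approximableZ (a : R) (u : T -> R) : L2_approximable u ->
  L2_approximable (fun x => a * u x).
Proof.
move=> [mu au]; split; first exact: measurable_funM.
move=> e e0; have a1 : 0 < a ^+ 2 + 1 by rewrite ltr_wpDl ?sqr_ge0.
have [f Df fu] := au (e / (a ^+ 2 + 1)) (divr_gt0 e0 a1).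
exists (a *: f); first exact: (dom_scale algD).
have mfu : measurable_fun (setT : set T) (fun x => f x - u x).
  by apply: measurable_funB => //; exact: dom_measurable.
have -> : (fun x => (a *: f) x - a * u x) = (fun x => a * (f x - u x)).
  by apply/funext => x; rewrite fctZE mulrBr.
rewrite sqintZ//.
have H : ((a ^+ 2 + 1)%:E * sqint m (fun x => f x - u x)%R < e%:E)%E.
  by rewrite -[e](divfK (lt0r_neq0 a1)) [e / _ * _]mulrC (EFinM (a ^+ 2 + 1)) lte_pmul2l.
apply: le_lt_trans H; apply: lee_wpmul2r; first exact: sqint_ge0.
by rewrite lee_fin lerDl.
Qed.

Lemma L2_approximable_sum (I : Type) (r : seq I) (u : I -> T -> R) :
  (forall i, L2_approximable (u i)) ->
  L2_approximable (fun x => \sum_(i <- r) u i x).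
Proof.
move=> au; elim: r => [|i r IH].
  have -> : (fun x => \sum_(i <- [::]) u i x) = (\1_set0 : T -> R).
    by apply/funext => x; rewrite big_nil indic0.
  exact: L2_approximable_indic.
under eq_fun do rewrite big_cons.
exact: L2_approximableD.
Qed.

Lemma L2_approximable_closed (u : T -> R) (v : nat -> T -> R) :
  measurable_fun setT u -> (forall n, L2_approximable (v n)) ->
  sqint m (fun x => v n x - u x) @[n --> \oo] --> 0%E -> L2_approximable u.
Proof.
move=> mu av vu; split => // e e0; have e4 : 0 < e / 4 by rewrite divr_gt0.
have [N NP] := (cvge0P (fun n => sqint_ge0 m _)).1 vu _ e4.
have [mv /(_ _ e4)[f Df fv]] := av N.
exists f => //; apply: (@sqintB_triangle _ (v N)) => //; last exact: NP.
exact: dom_measurable.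
Qed.

(** Simple functions increase to [u], and the squares of the errors are dominated by the square of
    [u]. *)
Lemma L2_approximable_nonneg (u : T -> R) : measurable_fun setT u ->
  (forall x, 0 <= u x) -> m.-integrable setT (fun x => (u x ^+ 2)%:E) ->
  L2_approximable u.
Proof.
move=> mu u0 iu.
have mEu : measurable_fun setT (EFin \o u) by exact/measurable_EFinP.
pose v := nnsfun_approx measurableT mEu.
have u0' x : [set: T] x -> (0 <= (EFin \o u) x)%E by move=> _; rewrite lee_fin.
have vu n x : v n x <= u x.
  by rewrite -lee_fin /v nnsfun_approxE; exact: (@le_approx _ _ _ setT (EFin \o u)).
have cv x : v n x @[n --> \oo] --> u x.
  by have /fine_cvgP[_] := cvg_nnsfun_approx measurableT mEu u0' (I : [set: T] x).
have mv n : measurable_fun setT (v n) by exact: measurable_funP.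
apply: (@L2_approximable_closed _ v) => //.
  move=> n; rewrite (funext (fimfunEord (v n))).
  apply: L2_approximable_sum => i; apply: L2_approximableZ.
  exact: L2_approximable_indic.
apply: (@sqint_cvg0 _ _ _ _ _ u) => //.
- by move=> n; exact: measurable_funB.
- by move=> n x; have := vu n x; have : 0 <= v n x by []; 
    rewrite ler_norml => ? ?; apply/andP; split; have := u0 x; lra.
- move=> x; rewrite -(subrr (u x)); apply: cvgB => //; exact: cvg_cst.
Qed.

Lemma closure_dense_of_algebra : closure_dense m.
Proof.
move=> u mu iu.
have part (p : T -> R) : measurable_fun setT p -> (forall x, 0 <= p x <= `|u x|) ->
    L2_approximable p.
  move=> mp pu; apply: L2_approximable_nonneg => //.
    by move=> x; case/andP: (pu x).
  apply: le_integrable iu => //; first exact: sqint_measurable.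
  move=> x _; have /andP[p0 p1] := pu x.
  rewrite !abse_EFin lee_fin !ger0_norm ?sqr_ge0//.
  by rewrite -[leRHS]real_normK ?num_real// ler_pXn2r ?nnegrE.
have [_ app] : L2_approximable u.
  have -> : u = fun x => Num.max (u x) 0 + (-1) * Num.max (- u x) 0.
    by apply/funext => x; case: (leP (u x) 0) => ?; case: (leP (- u x) 0) => ?; lra.
  apply: L2_approximableD; last apply: L2_approximableZ; apply: part.
  - exact: measurable_maxr.
  - by move=> x; rewrite le_max lexx orbT/= ge_max ler_norm normr_ge0.
  - by apply: measurable_maxr => //; exact: measurableT_comp.
  - by move=> x; rewrite le_max lexx orbT/= ge_max -normrN ler_norm normr_ge0.
have H (n : nat) : exists f, D f /\ (sqint m (fun x => f x - u x)%R < (n.+1%:R^-1)%:E)%E.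
  by have [|f Df fu] := app n.+1%:R^-1; rewrite ?invr_gt0//; exists f.
have [f fP] := choice H; exists f; split; first by move=> n; case: (fP n).
apply/(cvge0P (fun n => sqint_ge0 m (fun x => f n x - u x))) => e e0.
have [N _ NP] := near_infty_natSinv_lt (PosNum e0); exists N => n /NP ne.
by apply: lt_trans (fP n).2 _; rewrite lte_fin.
Qed.

End Density.

(** * The Markov property of the closure *)

Section MarkovClosure.
Variables (R : realType) (X : pointedType).
Variables (D : set (X -> R)) (E : (X -> R) -> (X -> R) -> R).
Variable m : {finite_measure set (g_sigma_algebraType (sigmaGen D)) -> \bar R}.
Hypotheses (algD : bounded_algebra D) (formE : bilinear_form E D)
           (contrE : contractions_operate E D).
Local Notation T := (g_sigma_algebraType (sigmaGen D)).
Implicit Types (f g h k : X -> R).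

Lemma E_cauchy_cvg (f : nat -> X -> R) : (forall n, D (f n)) -> E_cauchy E f ->
  cvg (E (f n) (f n) @[n --> \oo]).
Proof.
move=> Df cf; have E_ge0' := E_ge0 formE.
have [N1 N1P] := cf 1 ltr01.
pose C := 2 + 2 * E (f N1) (f N1).
have EC n : (N1 <= n)%N -> E (f n) (f n) <= C.
  move=> Nn; have -> : f n = (f n - f N1) + f N1 by rewrite subrK.
  apply: le_trans (E_le2 algD formE (dom_sub algD (Df n) (Df N1)) (Df N1)) _.
  by rewrite /C lerD2r; have := N1P _ _ Nn (leqnn N1);
    rewrite -[(fun x => f n x - f N1 x)]/(f n - f N1); lra.
have C0 : 0 < C + 1 by have := E_ge0' _ (Df N1); rewrite /C; lra.
apply: cauchy_cvg; apply: cauchy_exP => e e0.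
(* The mixed term obeys [2 |E a b| <= E a a / t + t * E b b]. This [t] makes the last summand at
   most [e / 2], and [d] then makes [(1 + 1 / t) * E a a] less than [e / 2]. *)
pose t := e / (2 * (C + 1)).
have t0 : 0 < t by rewrite divr_gt0// mulr_gt0.
pose d := e / (2 * (1 + t^-1)).
have t1 : 0 < 1 + t^-1 by rewrite addr_gt0// invr_gt0.
have d0 : 0 < d by rewrite divr_gt0// mulr_gt0.
have [N2 N2P] := cf d d0.
pose N := maxn N1 N2; exists (E (f N) (f N)); exists N => // n /= Nn.
have NN1 : (N1 <= N)%N by exact: leq_maxl.
have NN2 : (N2 <= N)%N by exact: leq_maxr.
have := N2P _ _ (leq_trans NN2 Nn) NN2; rewrite -[(fun x => f n x - _)]/(f n - f N).
set a := f n - f N => Ea.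
have Da : D a by exact: (dom_sub algD).
have := EC N NN1; set b := f N => Eb.
have Db : D b by exact: Df.
have -> : f n = a + b by rewrite /a subrK.
rewrite (E_quadD algD formE Da Db).
have p1 := E_ge0' _ (dom_add algD Da (dom_scale algD t Db)).
have p2 := E_ge0' _ (dom_sub algD Da (dom_scale algD t Db)).
rewrite (E_quadD algD formE Da (dom_scale algD t Db)) in p1.
rewrite (E_quadB algD formE Da (dom_scale algD t Db)) in p2.
rewrite (E_quadZ algD formE t Db) (EZr algD formE t Da Db) in p1.
rewrite (E_quadZ algD formE t Db) (EZr algD formE t Da Db) in p2.
have Ea0 := E_ge0' _ Da.
have ab : `|2 * E a b| <= t^-1 * E a a + t * C.
  rewrite -(ler_pM2l t0) -[X in X * `|_|](gtr0_norm t0) -normrM.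
  rewrite (_ : t * (t^-1 * _ + _) = E a a + t ^+ 2 * C); last by field; rewrite gt_eqF.
  have tC : t ^+ 2 * E b b <= t ^+ 2 * C by rewrite ler_wpM2l ?sqr_ge0.
  by rewrite ler_norml; apply/andP; split; lra.
have dE : (1 + t^-1) * E a a < e / 2.
  have -> : e / 2 = (1 + t^-1) * d by rewrite /d; field; rewrite !gt_eqF// addr_gt0.
  by rewrite ltr_pM2l.
have tE : t * C <= e / 2.
  have -> : e / 2 = t * (C + 1) by rewrite /t; field; rewrite gt_eqF.
  by rewrite ler_pM2l//; lra.
rewrite /ball/= distrC addrAC addrK (le_lt_trans (ler_normD _ _))// (ger0_norm Ea0); lra.
Qed.

Lemma closure_markov_of_contraction : closure_markov E m.
Proof.
move=> u f mu Df cf fu.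
pose L := limn (fun n => E (f n) (f n)).
have cvgf := E_cauchy_cvg Df cf.
pose F (y : R) := Num.min (Num.max y 0) 1.
have FE y : F y = clamp 0 1 y.
  rewrite /F; have [y0|/ltW y0] := leP y 0.
    by rewrite clamp_lo// (min_idPl ler01).
  have [y1|/ltW y1] := leP y 1; first by rewrite clamp_id// y0.
  by rewrite clamp_hi.
have cF : normal_contraction F.
  by rewrite (_ : F = clamp 0 1); [apply: clamp_contraction; rewrite lexx ler01|exact/funext].
have mFu : measurable_fun (setT : set T) (fun x => F (u x)).
  by apply: measurable_minr => //; apply: measurable_maxr.
(* The hypothesis bounds the energy of [F \o f n], not that of differences of such functions. These
   convex sets contain contracted members of the sequence, and an E-Cauchy selection from them has
   the required limit and energy. *)
pose K (n : nat) := [set h | [/\ D h, E h h <= L + n.+1%:R^-1 &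
  (sqint m (fun x => h x - F (u x))%R <= (n.+1%:R^-1)%:E)%E]].
have mhF h : D h -> measurable_fun (setT : set T) (fun x => h x - F (u x)).
  by move=> Dh; apply: measurable_funB => //; exact: dom_measurable.
have [|||||g gK gE] := @cauchy_of_nested_convex _ _ _ _ algD formE K (L + 1).
- by move=> n h [].
- move=> n k nk h [Dh Eh hu].
  have nk' : (k.+1%:R^-1 : R) <= n.+1%:R^-1 by rewrite lef_pV2 ?posrE// ler_nat.
  by split => //; [rewrite (le_trans Eh)// lerD2l|rewrite (le_trans hu)// lee_fin].
- move=> n h k; rewrite /K /=; move: (n.+1%:R^-1) => r [Dh Eh hu] [Dk Ek ku].
  have Dhk := dom_add algD Dh Dk.
  split; first exact: (dom_scale algD).
    rewrite (E_quadZ algD formE)// (_ : 2^-1 ^+ 2 = 4^-1 :> R); last by field.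
    by have := E_le2 algD formE Dh Dk; lra.
  have -> : (fun x => (2^-1 *: (h + k)) x - F (u x)) =
      (fun x => 2^-1 * ((h x - F (u x)) + (k x - F (u x)))).
    by apply/funext => x; rewrite fctZE !fctE; field.
  rewrite sqintZ; last by apply: measurable_funD; exact: mhF.
  have -> : r%:E = ((2^-1 ^+ 2)%:E * (2%:E * r%:E + 2%:E * r%:E))%E.
    by rewrite -(EFinM 2 r) -EFinD -EFinM; congr EFin; field.
  apply: lee_wpmul2l; first by rewrite lee_fin sqr_ge0.
  apply: le_trans (sqintD m (mhF _ Dh) (mhF _ Dk)) _.
  by apply: leeD; apply: lee_wpmul2l.
- move=> n; have r0 : (0 : R) < n.+1%:R^-1 by rewrite invr_gt0.
  have [N1 _ N1P] := cvgr_lt L cvgf (L + n.+1%:R^-1) (ltr_pwDr r0 (lexx L)).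
  have [N2 N2P] := (cvge0P (fun n => sqint_ge0 m (fun x => f n x - u x))).1 fu _ r0.
  pose N := maxn N1 N2.
  have [DFf EFf] := contrE cF (Df N).
  exists (F \o f N); split => //.
    by rewrite (le_trans EFf)// ltW// N1P//= leq_maxl.
  apply: ltW; apply: le_lt_trans (N2P N (leq_maxr _ _)).
  apply: sqint_le; first exact: (mhF _ DFf).
    by apply: measurable_funB => //; exact: dom_measurable.
  by move=> x; exact: (cF.2).
- move=> n h [_ Eh _]; by rewrite (le_trans Eh)// lerD2l invf_le1 ?ltr0n// ler1n.
have Dg n : D (g n) by case: (gK n).
have inv_small (e : R) : 0 < e -> exists N, forall n, (N <= n)%N -> (n.+1%:R^-1 : R) < e.
  by move=> e0; have [N _ NP] := near_infty_natSinv_lt (PosNum e0); exists N => n /NP.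
exists g; split => //.
  apply/(cvge0P (fun n => sqint_ge0 m (fun x => g n x - F (u x)))) => e e0.
  have [N NP] := inv_small e e0; exists N => n /NP ne.
  by have [_ _ gu] := gK n; rewrite (le_lt_trans gu)// lte_fin.
apply/ler_addgt0Pr => e e0; apply: limr_le; first exact: E_cauchy_cvg.
have [N NP] := inv_small e e0; exists N => // n /NP ne.
by have [_ Eg _] := gK n; rewrite (le_trans Eg)// lerD2l ltW.
Qed.

End MarkovClosure.

(** * Energy measures *)

(** The set function is packed twice, as a measure for the conclusion and as a charge for the
    Radon-Nikodym derivative; the latter is finite everywhere, so [fine] loses nothing. *)
Lemma dominated_measure_density d (T : measurableType d) (R : realType)
    (m : {finite_measure set T -> \bar R}) (mu : set T -> \bar R) :
  mu set0 = 0%E -> (forall A, (0 <= mu A)%E) -> (forall A, mu A \is a fin_num) ->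
  semi_sigma_additive mu -> (forall A, measurable A -> m A = 0%E -> mu A = 0%E) ->
  exists nu : {measure set T -> \bar R}, (forall A, nu A = mu A) /\
    exists g : T -> R, m.-integrable setT (EFin \o g) /\
      forall A, measurable A -> nu A = (\int[m]_(x in A) (g x)%:E)%E.
Proof.
move=> mu0 mu_ge0 mu_fin mu_sigma mu_dom.
pose M := isMeasure.Build _ _ _ mu mu0 mu_ge0 mu_sigma.
pose nu : {measure set T -> \bar R} := HB.pack mu M.
pose C := isCharge.Build _ _ _ mu mu0 (fun A _ => mu_fin A) mu_sigma.
pose ch : {charge set T -> \bar R} := HB.pack mu C.
have chm : ch `<< m by apply/null_content_dominatesP.
exists nu; split => //; exists (fun x => fine (Radon_Nikodym ch m x)).
have gE : EFin \o (fun x => fine (Radon_Nikodym ch m x)) = Radon_Nikodym ch m.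
  by apply/funext => x /=; rewrite fineK//; exact: Radon_Nikodym_fin_num.
split; first by rewrite gE; exact: Radon_Nikodym_integrable.
move=> A mA; have -> : nu A = ch A by [].
rewrite (Radon_Nikodym_integral chm mA); apply: eq_integral => x _.
by rewrite -[LHS](congr1 (fun h => h x) gE).
Qed.

(** Here [s] and [t] approximate the indicators [a] and [b] of disjoint sets at one point. As at
    most one of these is 1, any excess of [s + t] over 1 is paid for by the approximation errors. *)
Lemma truncated_sum_dist (R : realFieldType) (a b : bool) (s t : R) :
  0 <= s <= 1 -> 0 <= t <= 1 -> ~~ (a && b) ->
  [/\ 0 <= s + t - Num.min (s + t) 1 <= 1,
    `|s + t - Num.min (s + t) 1| <= `|s - a%:R| + `|t - b%:R| &
    `|Num.min (s + t) 1 - (a || b)%:R| <= `|s - a%:R| + `|t - b%:R|].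
Proof.
move=> /andP[s0 s1] /andP[t0 t1].
have := ler_norm (s - a%:R); have := ler_norm (- (s - a%:R)).
have := ler_norm (t - b%:R); have := ler_norm (- (t - b%:R)).
rewrite !normrN; move: `|s - a%:R| `|t - b%:R| => u v.
case: a; case: b; rewrite ?mulr1n ?mulr0n//=; case: (leP (s + t) 1) => ? ? ? ? ? _;
  by split; rewrite ?ler_norml; apply/andP; split; lra.
Qed.

Section CarreDuChamp.
Variables (R : realType) (X : pointedType).
Variables (D : set (X -> R)) (E : (X -> R) -> (X -> R) -> R) (chi : X -> R).
Variable m : {finite_measure set (g_sigma_algebraType (sigmaGen D)) -> \bar R}.
Hypotheses (algD : bounded_algebra D) (formE : bilinear_form E D)
           (closE : supnorm_closable E D) (contrE : contractions_operate E D)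
           (Dchi : D chi) (chi_gt0 : forall x, 0 < chi x)
           (domE : energy_dominant E m).
Variables (f : X -> R) (Df : D f).
Local Notation T := (g_sigma_algebraType (sigmaGen D)).
Local Notation L := (Defs.Lfun E f).
Implicit Types (h k : X -> R) (A B : set T).

Let mD h : D h -> measurable_fun (setT : set T) (h : T -> R).
Proof. exact: dom_measurable. Qed.

Let mI A : measurable A -> measurable_fun (setT : set T) (\1_A : T -> R).
Proof. by move=> mA; exact: measurable_indic. Qed.

Let DB' := dom_sub algD.
Let DD' := dom_add algD.

(** Positivity gives [|L h - L k| <= L |h - k|], and [|h - k|] is again a [[0, 1]]-valued function
    in [D]. *)
Lemma L_uniformly_continuous (eps : R) : 0 < eps -> exists2 delta : R, 0 < delta &
  forall h k, D h -> D k -> (forall x, 0 <= h x <= 1) -> (forall x, 0 <= k x <= 1) ->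
    (sqint m (fun x => h x - k x)%R < delta%:E)%E -> `|L h - L k| < eps.
Proof.
move=> eps0.
have [d d0 dP] := energy_dominant_L2 algD formE closE contrE domE Df eps0; exists d => //.
move=> h k Dh Dk h01 k01 hk.
have Dhk : D (h - k) by exact: DB'.
pose p := fun x => `|(h - k) x|.
have Dp : D p by exact: (dom_abs contrE Dhk).
have Lp : L p < eps.
  apply: dP => //.
    move=> x; rewrite /p !fctE normr_ge0 ler_norml/=.
    by have /andP[? ?] := h01 x; have /andP[? ?] := k01 x; apply/andP; split; lra.
  rewrite (_ : sqint m p = sqint m (fun x => h x - k x)%R)//.
  by apply: eq_integral => x _; rewrite /p !fctE real_normK ?num_real.
rewrite -(LB algD formE)//.
have l1 : L (h - k) <= L p.
  by apply: (L_le_mono algD formE closE contrE) => // x; exact: ler_norm.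
have l2 : L (- (h - k)) <= L p.
  apply: (L_le_mono algD formE closE contrE) => //; first exact: (dom_opp algD).
  by move=> x; rewrite /p (_ : (- (h - k)) x = - (h - k) x)// -normrN ler_norm.
rewrite -scaleN1r (LZ algD formE)// mulN1r in l2.
by rewrite ltr_norml; apply/andP; split; lra.
Qed.

Let approxP A (n : nat) : exists h, measurable A -> [/\ D h, forall x, 0 <= h x <= 1 &
  (sqint m (fun x => h x - \1_A x)%R < (n.+1%:R^-1)%:E)%E].
Proof.
have [mA|nA] := pselect (measurable A); last by exists 0.
have [|h hP] := (measurable_approximable m algD contrE Dchi chi_gt0 mA).2 n.+1%:R^-1.
  by rewrite invr_gt0.
by exists h.
Qed.

Let appr A n : X -> R := projT1 (cid (approxP A n)).

Let apprP A n : measurable A -> [/\ D (appr A n), forall x, 0 <= appr A n x <= 1 &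
  (sqint m (fun x => appr A n x - \1_A x)%R < (n.+1%:R^-1)%:E)%E].
Proof. exact: (projT2 (cid (approxP A n))). Qed.

Let inv_small (e : R) : 0 < e -> exists N, forall n, (N <= n)%N -> (n.+1%:R^-1 : R) < e.
Proof.
by move=> e0; have [N _ NP] := near_infty_natSinv_lt (PosNum e0); exists N => n /NP.
Qed.

(* Junk value if [A] is not measurable. *)
Definition energy_value A : R := limn (fun n => L (appr A n)).

(** Frees the value from the chosen approximants. That [delta] does not depend on [A] is what later
    yields countable additivity. *)
Lemma energy_valueP (eps : R) : 0 < eps -> exists2 delta : R, 0 < delta &
  forall A h, measurable A -> D h -> (forall x, 0 <= h x <= 1) ->
    (sqint m (fun x => h x - \1_A x)%R < delta%:E)%E -> `|L h - energy_value A| <= eps.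
Proof.
have cv A : measurable A -> cvg (L (appr A n) @[n --> \oo]).
  move=> mA; apply: cauchy_cvg; apply: cauchy_exP => e e0.
  have [d d0 dP] := L_uniformly_continuous e0.
  have d4 : 0 < d / 4 by rewrite divr_gt0.
  have [N NP] := inv_small d4.
  exists (L (appr A N)); exists N => // n /= Nn.
  have [D1 h01 s1] := apprP N mA; have [D2 h02 s2] := apprP n mA.
  rewrite /ball/=; apply: dP => //.
  apply: (@sqintB_triangle _ _ _ _ _ (\1_A)); [exact: mD|exact: mI|exact: mD|..].
    by apply: lt_trans s1 _; rewrite lte_fin NP.
  by rewrite sqintBC; apply: lt_trans s2 _; rewrite lte_fin NP.
move=> eps0; have [d d0 dP] := L_uniformly_continuous eps0.
have d4 : 0 < d / 4 by rewrite divr_gt0.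
exists (d / 4) => // A h mA Dh h01 hA.
have [N NP] := inv_small d4.
have H n : (N <= n)%N -> `|L h - L (appr A n)| <= eps.
  move=> Nn; have [D2 h02 s2] := apprP n mA.
  apply/ltW/dP => //.
  apply: (@sqintB_triangle _ _ _ _ _ (\1_A)); [exact: mD|exact: mI|exact: mD|exact: hA|].
  by rewrite sqintBC; apply: lt_trans s2 _; rewrite lte_fin NP.
rewrite ler_norml; apply/andP; split.
  suff : energy_value A <= L h + eps by lra.
  apply: limr_le; first exact: cv.
  by exists N => // n /H; rewrite ler_norml => /andP[]; lra.
suff : L h - eps <= energy_value A by lra.
apply: limr_ge; first exact: cv.
by exists N => // n /H; rewrite ler_norml => /andP[]; lra.
Qed.

Let get_approx A (e : R) : measurable A -> 0 < e -> exists h, [/\ D h,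
  forall x, 0 <= h x <= 1 & (sqint m (fun x => h x - \1_A x)%R < e%:E)%E].
Proof. by move=> mA; exact: (measurable_approximable m algD contrE Dchi chi_gt0 mA).2. Qed.

Lemma energy_value_continuous (eps : R) : 0 < eps -> exists2 delta : R, 0 < delta &
  forall A B, measurable A -> measurable B ->
    (sqint m (fun x => \1_A x - \1_B x)%R < delta%:E)%E ->
    `|energy_value A - energy_value B| <= eps.
Proof.
move=> eps0; have [d d0 dP] := energy_valueP (divr_gt0 eps0 (ltr0n _ 2 : 0 < 2)).
have d4 : 0 < d / 4 by rewrite divr_gt0.
exists (d / 4) => // A B mA mB AB; have [h [Dh h01 hA]] := get_approx mA d4.
have hB : (sqint m (fun x => h x - \1_B x)%R < d%:E)%E.
  by apply: (@sqintB_triangle _ _ _ _ _ (\1_A)); [exact: mD|exact: mI|exact: mI|exact: hA|].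
have := dP _ _ mB Dh h01 hB.
have : `|L h - energy_value A| <= eps / 2.
  apply: dP => //; apply: lt_trans hA _; rewrite lte_fin; lra.
rewrite !ler_norml => /andP[? ?] /andP[? ?]; apply/andP; split; lra.
Qed.

Lemma energy_value_ge0 A : measurable A -> 0 <= energy_value A.
Proof.
move=> mA; apply/ler_addgt0Pr => e e0.
have [d d0 dP] := energy_valueP e0; have [h [Dh h01 hA]] := get_approx mA d0.
have := dP _ _ mA Dh h01 hA; rewrite ler_norml => /andP[? ?].
have : 0 <= L h.
  by apply: (L_ge0 algD formE closE contrE) => // x; case/andP: (h01 x).
lra.
Qed.

Lemma energy_value_null A : measurable A -> m A = 0%E -> energy_value A = 0.
Proof.
move=> mA mA0; apply/eqP; rewrite eq_le energy_value_ge0// andbT.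
apply/ler_addgt0Pr => e e0.
have [d d0 dP] := energy_valueP e0.
have := dP A 0 mA (dom0 algD).
rewrite (_ : L 0 = 0); last by rewrite -(scale0r f) (LZ algD formE)// mul0r.
rewrite sub0r normrN ler_norml => H; have /andP[] : - e <= energy_value A <= e; last lra.
apply: H; first by move=> x; rewrite lexx ler01.
have -> : sqint m (fun x => (0 : X -> R) x - \1_A x) = m A.
  rewrite sqintBC -(sqint_indic m mA); apply: eq_integral => x _.
  by rewrite subr0.
by rewrite mA0 lte_fin.
Qed.

Lemma energy_valueU A B : measurable A -> measurable B -> A `&` B = set0 ->
  energy_value (A `|` B) = energy_value A + energy_value B.
Proof.
move=> mA mB AB0; have mAB : measurable (A `|` B) by exact: measurableU.
suff H (e : R) : 0 < e -> `|energy_value (A `|` B) - (energy_value A + energy_value B)| <= e.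
  apply/eqP; rewrite -subr_eq0 -normr_eq0 eq_le normr_ge0 andbT.
  by apply/ler_addgt0Pr => e /H; rewrite add0r.
move=> e0; have e4 : 0 < e / 4 by rewrite divr_gt0.
have [d1 d10 d1P] := energy_valueP e4.
have [d2 d20 d2P] := energy_dominant_L2 algD formE closE contrE domE Df e4.
pose d := Num.min d1 d2 / 4.
have d0 : 0 < d by rewrite divr_gt0// lt_min d10.
have dd1 : d <= d1 / 4 by rewrite ler_pM2r ?invr_gt0// ge_min lexx.
have dd2 : d <= d2 / 4 by rewrite ler_pM2r ?invr_gt0// ge_min lexx orbT.
have [h [Dh h01 hA]] := get_approx mA d0; have [k [Dk k01 kB]] := get_approx mB d0.
have DDD : D (h + k) by exact: DD'.
(* The truncated sum approximates the indicator of the union, and the excess [p] is small in mean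
   square by disjointness; hence [L l] differs little from [L h + L k]. *)
pose l := fun x => clamp 0 1 ((h + k) x).
have Dl : D l by apply: (dom_clamp contrE _ DDD); rewrite lexx ler01.
pose p := (h + k) - l; have Dp : D p by exact: DB'.
have lle x : l x = Num.min ((h + k) x) 1.
  rewrite /l; have /andP[? ?] := h01 x; have /andP[? ?] := k01 x.
  have s0 : 0 <= (h + k) x by rewrite !fctE addr_ge0.
  have [s1|/ltW s1] := leP ((h + k) x) 1; first by rewrite clamp_id// s0.
  by rewrite clamp_hi.
have disj x : ~ ((x \in A) && (x \in B)).
  by rewrite -in_setI AB0 in_set0.
have tri x : [/\ 0 <= p x <= 1, `|p x| <= `|h x - \1_A x| + `|k x - \1_B x| &
    `|l x - \1_(A `|` B) x| <= `|h x - \1_A x| + `|k x - \1_B x|].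
  have px : p x = h x + k x - l x by [].
  rewrite px lle !fctE !indicE in_setU.
  by apply: truncated_sum_dist => //; apply/negP; exact: disj.
have Lp : `|L p| < e / 4.
  have p01 x : 0 <= p x <= 1 by case: (tri x).
  rewrite ger0_norm; last first.
    by apply: (L_ge0 algD formE closE contrE) => // x; case/andP: (p01 x).
  apply: d2P => //.
  apply: (@sqint_lt_triangle _ _ _ m _ (fun x => h x - \1_A x) (fun x => k x - \1_B x)).
  - exact: mD.
  - by apply: measurable_funB; [exact: mD|exact: mI].
  - by apply: measurable_funB; [exact: mD|exact: mI].
  - by move=> x; case: (tri x).
  - by apply: lt_le_trans hA _; rewrite lee_fin.
  - by apply: lt_le_trans kB _; rewrite lee_fin.
have vA : `|L h - energy_value A| <= e / 4.
  by apply: d1P => //; apply: lt_le_trans hA _; rewrite lee_fin; lra.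
have vB : `|L k - energy_value B| <= e / 4.
  by apply: d1P => //; apply: lt_le_trans kB _; rewrite lee_fin; lra.
have vAB : `|L l - energy_value (A `|` B)| <= e / 4.
  apply: d1P => //; first by move=> x; exact: clamp_itv.
  apply: (@sqint_lt_triangle _ _ _ m _ (fun x => h x - \1_A x) (fun x => k x - \1_B x)).
  - by apply: measurable_funB; [exact: mD|exact: mI].
  - by apply: measurable_funB; [exact: mD|exact: mI].
  - by apply: measurable_funB; [exact: mD|exact: mI].
  - by move=> x; case: (tri x).
  - by apply: lt_le_trans hA _; rewrite lee_fin.
  - by apply: lt_le_trans kB _; rewrite lee_fin.
have Lhk : L h + L k = L l + L p.
  by rewrite -(LD algD formE)// -(LD algD formE)// /p [l + _]addrC subrK.
move: Lp vA vB vAB; rewrite ltr_norml !ler_norml.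
by move=> /andP[? ?] /andP[? ?] /andP[? ?] /andP[? ?]; apply/andP; split; lra.
Qed.

Lemma energy_value0 : energy_value set0 = 0.
Proof. by apply: energy_value_null. Qed.

Lemma energy_value_le A B : measurable A -> measurable B -> A `<=` B ->
  energy_value A <= energy_value B.
Proof.
move=> mA mB AB; have -> : B = A `|` (B `\` A) by rewrite setDUK.
rewrite energy_valueU ?setDIK//; last exact: measurableD.
by rewrite lerDl energy_value_ge0//; exact: measurableD.
Qed.

Lemma energy_value_sum (F : nat -> set T) n : (forall i, measurable (F i)) ->
  trivIset setT F ->
  energy_value (\big[setU/set0]_(i < n) F i) = \sum_(0 <= i < n) energy_value (F i).
Proof.
move=> mF tF; elim: n => [|n IH]; first by rewrite big_ord0 big_geq// energy_value0.
rewrite big_ord_recr big_nat_recr//= energy_valueU ?IH//.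
  exact: bigsetU_measurable.
rewrite -bigcup_mkord; apply/seteqP; split => // x [[i /= i_n Fix] Fnx].
have /trivIsetP/(_ i n I I) := tF; rewrite (ltn_eqF i_n) => /(_ isT).
by move=> /seteqP[+ _] => /(_ x); apply.
Qed.

(** Indicators of the partial unions converge in mean square, so continuity of the value upgrades
    finite additivity. *)
Lemma energy_value_sigma_additive (F : nat -> set T) : (forall i, measurable (F i)) ->
  trivIset setT F -> \sum_(0 <= i < n) energy_value (F i) @[n --> \oo] -->
  energy_value (\bigcup_n F n).
Proof.
move=> mF tF; apply/cvgrPdist_le => e e0.
have [d d0 dP] := energy_value_continuous e0.
pose G n := \big[setU/set0]_(i < n) F i.
have mG n : measurable (G n) by exact: bigsetU_measurable.
have mU : measurable (\bigcup_n F n) by exact: bigcupT_measurable.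
have [|||N NP] := @sqint_eventually _ _ _ m (fun n => \1_(G n)) _
  (fun n => mI (mG n)) (mI mU) _ _ _ _ d0.
- by move=> n x; exact: indic01.
- by move=> x; exact: indic01.
- move=> x; have [[i _ Fix]|nF] := pselect ((\bigcup_n F n) x).
    exists i.+1 => n ni; rewrite !indicE !mem_set//; first by exists i.
    by rewrite /G -bigcup_mkord; exists i.
  exists 0%N => n _; rewrite !indicE !memNset//.
  by rewrite /G -bigcup_mkord => -[i _ Fi]; apply: nF; exists i.
exists N => // n /= Nn; rewrite -energy_value_sum//.
by apply: (dP _ _ mU (mG n)); rewrite sqintBC; exact: NP.
Qed.

(** * Identification with the energy measure *)

Lemma Sets_measurable A : Sets D A -> measurable A.
Proof.
move=> [g Dg <-]; have := mD Dg measurableT (measurable_itv `]0, +oo[).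
by rewrite setTI; congr measurable; apply/seteqP; split => x /=; rewrite in_itv/= andbT.
Qed.

Lemma GammaS_energy_value B : Sets D B -> GammaS E D f B = (energy_value B)%:E.
Proof.
move=> SB; have mB := Sets_measurable SB; apply/eqP; rewrite eq_le; apply/andP; split.
  apply: ge_ereal_sup => _ [h [Dh hB] <-]; rewrite lee_fin.
  apply/ler_addgt0Pr => e e0.
  have [d d0 dP] := energy_valueP e0; have [k [Dk k01 kB]] := get_approx mB d0.
  (* A competitor [h] may be far from the indicator of [B]. Its maximum with [k] only increases [L],
     and it is as close to the indicator as [k] because [h <= \1_B]. *)
  pose l := fun x => Num.max (h x) (k x).
  have Dl : D l by exact: (dom_max algD contrE Dh Dk).
  have hl : L h <= L l.
    by apply: (L_le_mono algD formE closE contrE) => // x; rewrite /l le_max lexx.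
  have l01 x : k x <= l x /\ l x <= Num.max (k x) (\1_B x).
    have /andP[? ?] := hB x; rewrite /l.
    split; first by rewrite le_max lexx orbT.
    by rewrite ge_max; apply/andP; split; rewrite le_max ?lexx//; apply/orP; right.
  have : `|L l - energy_value B| <= e.
    apply: dP => //.
      move=> x; have [l1 l2] := l01 x; have /andP[? ?] := k01 x.
      rewrite (le_trans _ l1)//= (le_trans l2)// ge_max.
      by have /andP[_ ->] := indic01 B x; rewrite andbT.
    apply: le_lt_trans kB; apply: sqint_le.
    - by apply: measurable_funB; [exact: mD|exact: mI].
    - by apply: measurable_funB; [exact: mD|exact: mI].
    - move=> x; have [l1 +] := l01 x; have /andP[? ?] := k01 x.
      rewrite indicE; case: (x \in B) => /=.
        case: (leP (k x) 1) => ? l2; last lra.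
        by rewrite !ler0_norm ?mulr1n; lra.
      case: (leP (k x) 0) => ? l2; rewrite !subr0 !ger0_norm//; lra.
  by rewrite ler_norml => /andP[? ?]; lra.
apply/lee_addgt0Pr => e e0; have [d d0 dP] := energy_valueP e0.
have [g Dg gB] := SB.
(* These competitors vanish off [B] and are eventually 1 at each point of [B], so the supremum
   reaches the value. *)
pose h n := fun x => clamp 0 1 (n%:R * g x).
have Dh n : D (h n).
  apply: (dom_clamp contrE (f := n%:R *: g)); first by rewrite lexx ler01.
  exact: (dom_scale algD).
have h01 n x : 0 <= h n x <= 1 by exact: clamp_itv.
have hB n x : h n x <= \1_B x.
  rewrite indicE -gB; have [_|] := boolP (x \in _); first by case/andP: (h01 n x).
  rewrite notin_setE/= => /negP; rewrite -leNgt => gx.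
  by rewrite /h clamp_lo// mulr_ge0_le0.
have [||N NP] := @sqint_eventually _ _ _ m h _ (fun n => mD (Dh n)) (mI mB) h01 _ _ _ d0.
- by move=> x; exact: indic01.
- move=> x; rewrite indicE -gB; have [|] := boolP (x \in _).
    rewrite inE/= => gx; have [N NP] := eventually_ge1 gx.
    by exists N => n /NP ?; rewrite /h clamp_hi.
  rewrite notin_setE/= => /negP; rewrite -leNgt => gx.
  by exists 0%N => n _; rewrite /h clamp_lo// mulr_ge0_le0.
have := dP _ _ mB (Dh N) (h01 N) (NP _ (leqnn N)); rewrite ler_norml => /andP[LN _].
apply: (@le_trans _ _ ((L (h N))%:E + e%:E)%E).
  by rewrite -EFinD lee_fin; lra.
apply: leeD => //; apply: ereal_sup_ubound; exists (h N) => //; split => // x.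
by rewrite hB andbT; case/andP: (h01 N x).
Qed.

Lemma SetsU A B : Sets D A -> Sets D B -> Sets D (A `|` B).
Proof.
move=> [g Dg <-] [h Dh <-]; exists (fun x => Num.max (g x) (h x)).
  exact: (dom_max algD contrE Dg Dh).
apply/seteqP; split => x /=; rewrite lt_max; first by move/orP.
by move=> H; apply/orP.
Qed.

Lemma SetsI A B : Sets D A -> Sets D B -> Sets D (A `&` B).
Proof.
move=> [g Dg <-] [h Dh <-]; exists (fun x => Num.min (g x) (h x)).
  exact: (dom_min algD contrE Dg Dh).
apply/seteqP; split => x /=; rewrite lt_min; first by move/andP.
by move=> H; apply/andP.
Qed.

(* [~` B1] and [B2] play the roles of an inner compact and an outer open set. *)
Definition regular A := measurable A /\ forall eps : R, 0 < eps ->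
  exists B1 B2, [/\ Sets D B1, Sets D B2, ~` B1 `<=` A, A `<=` B2 &
    energy_value (B1 `&` B2) < eps].

Lemma regular_alphaS A : alphaS D A -> regular A.
Proof.
move: A; apply: smallest_sub.
  split.
  (* Positivity of [chi] puts the whole space into [Sets D], which provides the empty set as inner
     set. *)
  - split => // e e0; exists [set x | 0 < chi x], set0; split => //.
    + by exists chi.
    + by exists 0; [exact: (dom0 algD)|apply/seteqP; split => x //=; rewrite ltxx].
    + by move=> x /=; rewrite chi_gt0.
    + by rewrite setI0 energy_value0.
  - move=> A [mA rA]; split; first exact: measurableC.
    move=> e /rA[B1 [B2 [S1 S2 s1 s2 v]]]; exists B2, B1; split => //.
    + by move=> x nB Ax; apply: nB; exact: s2.
    + by move=> x nA; apply: contrapT => nB; apply: nA; exact: s1.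
    + by rewrite setIC.
  - move=> A A' [mA rA] [mA' rA']; split; first exact: measurableU.
    move=> e e0; have e2 : 0 < e / 2 by rewrite divr_gt0.
    have [B1 [B2 [S1 S2 s1 s2 v]]] := rA _ e2.
    have [B1' [B2' [S1' S2' s1' s2' v']]] := rA' _ e2.
    exists (B1 `&` B1'), (B2 `|` B2'); split.
    + exact: SetsI.
    + exact: SetsU.
    + by rewrite setCI => x [/s1|/s1']; [left|right].
    + by move=> x [/s2|/s2']; [left|right].
    + have mS1 := Sets_measurable S1; have mS2 := Sets_measurable S2.
      have mS1' := Sets_measurable S1'; have mS2' := Sets_measurable S2'.
      pose P := B1 `&` B2; pose Q := B1' `&` B2'.
      have mP : measurable P by exact: measurableI.
      have mQ : measurable Q by exact: measurableI.
      have le1 : energy_value ((B1 `&` B1') `&` (B2 `|` B2')) <= energy_value (P `|` (Q `\` P)).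
        apply: energy_value_le.
        * by apply: measurableI; [exact: measurableI|exact: measurableU].
        * by apply: measurableU => //; exact: measurableD.
        * by rewrite setUDr setDv setD0 => x [[? ?] [?|?]]; [left|right].
      have le2 : energy_value (Q `\` P) <= energy_value Q.
        by apply: energy_value_le => //; exact: measurableD.
      rewrite energy_valueU ?setDIK// in le1; last exact: measurableD.
      by rewrite -/P in v; rewrite -/Q in v'; lra.
move=> A SA; have mA := Sets_measurable SA; split => // e e0.
have [g Dg gA] := SA.
(* With [chi] standing in for a constant, the complement of [B n] is [{g >= chi / (n + 1)}], a
   subset of [A]; each point of [A] eventually leaves [B n], so the gap tends to zero. *)
pose B (n : nat) : set T := [set x | 0 < (n.+1%:R^-1 *: chi - g) x].
have SB n : Sets D (B n).
  by exists (n.+1%:R^-1 *: chi - g) => //; apply: DB' => //; exact: (dom_scale algD).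
have mBA n : measurable (B n `&` A) by apply: measurableI => //; exact: Sets_measurable.
have [d d0 dP] := energy_value_continuous (divr_gt0 e0 (ltr0n _ 2 : 0 < 2)).
have [|||N NP] := @sqint_eventually _ _ _ m (fun n => \1_(B n `&` A)) \1_set0
  (fun n => mI (mBA n)) (mI measurable0) _ _ _ _ d0.
- by move=> n x; exact: indic01.
- by move=> x; exact: indic01.
- move=> x; rewrite indic0; have [Ax|nA] := pselect (A x); last first.
    by exists 0%N => n _; rewrite indicE memNset// => -[].
  have gx : 0 < g x by move: Ax; rewrite -gA.
  have [N NP] := eventually_ge1 (divr_gt0 gx (chi_gt0 x)).
  exists N => n Nn; rewrite indicE memNset// => -[+ _]; rewrite /B/= !fctE/=.
  have := NP n.+1 (leq_trans Nn (leqnSn n)).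
  rewrite mulrA ler_pdivlMr// mul1r => cg.
  rewrite (_ : n.+1%:R^-1 *: chi x = n.+1%:R^-1 * chi x)// subr_gt0 mulrC ltr_pdivlMr//.
  by rewrite mulrC ltNge cg.
exists (B N), A; split => //.
  move=> x; rewrite -gA /B/= => /negP; rewrite -leNgt !fctE subr_le0.
  by apply: lt_le_trans; rewrite mulr_gt0// invr_gt0.
have := dP _ _ (mBA N) measurable0 (NP _ (leqnn N)).
by rewrite energy_value0 subr0 ler_norml => /andP[? ?]; lra.
Qed.

(** By regularity some [B2] in [Sets D] exceeds [A] by a part of [B1 & B2], whose value is small, so
    the outer infimum attains the value of [A]; the other inequality is monotonicity. *)
Lemma Gamma_energy_value A : alphaS D A -> Gamma E D f A = (energy_value A)%:E.
Proof.
move=> /regular_alphaS[mA rA]; rewrite /Gamma; case: asboolP => [SA|_].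
  exact: GammaS_energy_value.
apply/eqP; rewrite eq_le; apply/andP; split.
  apply/lee_addgt0Pr => e /rA[B1 [B2 [S1 S2 s1 s2 v]]].
  apply: (@le_trans _ _ (GammaS E D f B2)).
    by apply: ereal_inf_lbound; exists B2.
  have m1 := Sets_measurable S1; have m2 := Sets_measurable S2.
  rewrite GammaS_energy_value// -EFinD lee_fin.
  have -> : B2 = A `|` (B2 `\` A) by rewrite setDUK.
  rewrite energy_valueU ?setDIK//; last exact: measurableD.
  rewrite lerD2l (le_trans _ (ltW v))//; apply: energy_value_le.
  - exact: measurableD.
  - exact: measurableI.
  - by move=> x [B2x nAx]; split => //; apply: contrapT => nB; apply: nAx; exact: s1.
apply: le_ereal_inf_tmp => _ [B [SB AB] <-].
rewrite GammaS_energy_value// lee_fin; apply: energy_value_le => //.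
exact: Sets_measurable.
Qed.

Lemma energy_measure_density :
  exists mu : {measure set T -> \bar R},
    (forall A, alphaS D A -> mu A = Gamma E D f A) /\
    exists g : T -> R, m.-integrable setT (EFin \o g) /\
      forall A, measurable A -> mu A = (\int[m]_(x in A) (g x)%:E)%E.
Proof.
have valE A : measurable A -> `|energy_value A| = energy_value A.
  by move=> mA; rewrite ger0_norm// energy_value_ge0.
have [|||F mF tF mU||nu [nuE density]] :=
    (* The absolute value secures nonnegativity on nonmeasurable sets, where [energy_value] is
       arbitrary. *)
    @dominated_measure_density _ _ _ m (fun A => (`|energy_value A|)%:E).
- by rewrite valE// energy_value0.
- by move=> A; rewrite lee_fin.
- by [].
- rewrite valE//; under eq_fun do rewrite sumEFin.
  apply: cvg_EFin; first exact: nearW.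
  have := energy_value_sigma_additive mF tF; apply: cvg_trans; apply: near_eq_cvg.
  by apply: nearW => n /=; apply: eq_bigr => i _; rewrite valE.
- by move=> A mA /(energy_value_null mA) ->; rewrite normr0.
exists nu; split => // A aA; rewrite nuE (Gamma_energy_value aA) valE//.
by case: (regular_alphaS aA).
Qed.

End CarreDuChamp.

Theorem theoremT (R : realType) (X : pointedType) (D : set (X -> R))
    (chi : X -> R) (E : (X -> R) -> (X -> R) -> R)
    (m : {finite_measure set (g_sigma_algebraType (sigmaGen D)) -> \bar R}) :
  bounded_algebra D -> C1c_stable D -> D chi -> (forall x, 0 < chi x) ->
  bilinear_form E D -> supnorm_closable E D -> contractions_operate E D ->
  energy_dominant E m ->
  [/\ L2_closable E m, closure_dense m, closure_markov E m & carre_du_champ E m].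
Proof.
move=> algD _ Dchi chi_gt0 formE closE contrE domE; split.
- exact: L2_closable_of_dominance.
- exact: (closure_dense_of_algebra algD contrE Dchi chi_gt0).
- exact: closure_markov_of_contraction.
- by move=> f Df; exact: (energy_measure_density algD formE closE contrE Dchi chi_gt0 domE).
Qed.
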